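(* For every $n\ge1$, $\mathbf{k}=(k_1,\dots,k_n)\in\mathbb{N}^n$ and $0<\sigma<\pi$, and for either choice of signs (upper signs throughout or lower signs throughout), \[ \mathrm{Li}_{\mathbf{k}}(1-e^{\pm i\sigma})=(\mp i)^n\int_{0<\theta_{1}<\dots<\theta_{n}<\theta_{n+1}=\sigma}\prod_{u=1}^{n}\frac{\left(A(\theta_{u+1})-A(\theta_{u})\pm\frac{i\theta_{u+1}}{2}\mp\frac{i\theta_{u}}{2}\right)^{k_{u}-1}}{(k_{u}-1)!}\,d\theta_{u}, \] where $A(\theta)=\log|2\sin(\theta/2)|$.
   Context: $\mathbb{N}=\{1,2,3,\dots\}$. For $\mathbf{k}=(k_1,\dots,k_n)\in\mathbb{N}^n$ the multiple polylogarithm is $\mathrm{Li}_{\mathbf{k}}(z)=\sum_{0<m_1<\dots<m_n}\frac{z^{m_n}}{m_1^{k_1}\cdots m_n^{k_n}}$ for $|z|<1$, extended by analytic continuation to a holomorphic function on $\mathbb{C}\setminus[1,\infty)$. *)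

(* Defs.v *)
From Stdlib Require Import Reals Arith Factorial.
From Coquelicot Require Import Coquelicot.
Open Scope R_scope.

(* Coefficients of the multiple polylogarithm, with k : nat -> nat giving
   k_1, k_2, ... (index 0 unused).
   mpl_coef k j m = sum over 0 < m_1 < ... < m_j = m of
                    1 / (m_1^{k_1} ... m_j^{k_j})
   (for j = 0: the empty tuple, value 1 at m = 0 and 0 otherwise). *)
Fixpoint mpl_coef (k : nat -> nat) (j : nat) (m : nat) : R :=
  match j with
  | O => if Nat.eqb m 0 then 1 else 0
  | S j' => if Nat.eqb m 0 then 0
            else sum_f_R0 (fun l => mpl_coef k j' l) (m - 1) / (INR m ^ k (S j'))
  end.

Definition mpl_term (k : nat -> nat) (n : nat) (z : C) (m : nat) : C :=
  Cmult (RtoC (mpl_coef k n m)) (pow_n (K := C_Ring) z m).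

Definition slit_domain (z : C) : Prop := ~ (Im z = 0 /\ 1 <= Re z).

(* F is the multiple polylogarithm Li_k: holomorphic on C \ [1,oo) and equal to
   the defining series on the open unit disc (this determines F uniquely on the
   connected domain C \ [1,oo), i.e. F is the analytic continuation). *)
Definition is_mpl (k : nat -> nat) (n : nat) (F : C -> C) : Prop :=
  (forall z : C, slit_domain z -> ex_derive (K := C_AbsRing) (V := C_NormedModule) F z) /\
  (forall z : C, Cmod z < 1 ->
     is_series (K := C_AbsRing) (V := C_NormedModule) (mpl_term k n z) (F z)).

Definition cexpi (s : R) : C := (cos s, sin s).

Definition Afun (t : R) : R := ln (Rabs (2 * sin (t / 2))).

Definition integrand_factor (eps : R) (k : nat -> nat) (u : nat) (a b : R) : C :=
  Cmult (pow_n (K := C_Ring)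
           (Cplus (RtoC (Afun b - Afun a)) (Cmult (RtoC (eps * (b / 2 - a / 2))) Ci))
           (k u - 1)%nat)
        (RtoC (/ INR (fact (k u - 1)))).

(* Iterated integral over the simplex 0 < theta_1 < ... < theta_u < t:
   iter_int eps k 0 t = 1,
   iter_int eps k (u+1) t
     = int_{0}^{t} integrand_factor eps k (u+1) theta t * iter_int eps k u theta dtheta,
   each integral being an (improper at 0+) Riemann integral. *)
Fixpoint iter_int (eps : R) (k : nat -> nat) (u : nat) (t : R) : C :=
  match u with
  | O => RtoC 1
  | S u' => RInt_gen (V := C_R_CompleteNormedModule)
              (fun th => Cmult (integrand_factor eps k u th t) (iter_int eps k u' th))
              (at_right 0) (at_point t)
  end.

Definition iter_int_exists (eps : R) (k : nat -> nat) (n : nat) (sigma : R) : Prop :=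
  forall (u : nat) (t : R), (1 <= u <= n)%nat -> 0 < t <= sigma ->
    ex_RInt_gen (V := C_R_NormedModule)
      (fun th => Cmult (integrand_factor eps k u th t) (iter_int eps k (u - 1) th))
      (at_right 0) (at_point t).

(* Main.v *)
(** The map [kappa w = 4w/(1+w)^2] sends the unit disc onto C \ [1,oo), and the
    arc [1 - e^{i eps t}], [0 < t < PI], is the image of the radius
    [w = - i eps tan(t/4)].  In the coordinate [w] the forms [dz/(1-z)] and [dz/z]
    are rational with poles on the unit circle only (and at 0 for [dz/z]), so the
    iterated integrals giving the multiple polylogarithms are power series in [w]
    converging on the whole disc.  By the identity theorem on the disc, [Li o kappa]
    is this power series [P].  As [Li] is only assumed complex differentiable, this
    rests on Goursat's lemma, applied to [g(e^zeta)] to get the mean value property.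

    On the radius, put [L = log z_t - log z_s], where [log z_s = A(s) + i eps s/2] up
    to a constant.  Then [sum_q L^q/q! P_{k_1..k_{n-1},p+1-q}(s)], [0 <= q <= p = k_n - 1],
    has [s]-derivative [(- i eps) L^p/p! P_{k_1..k_{n-1}}(s)], it tends to 0 as [s -> 0+],
    and at [s = t] it is [P_{k_1..k_n}(t)], so induction on [n] concludes. *)

Require Import Defs.
From Stdlib Require Import Reals Lra Lia Psatz Factorial ClassicalEpsilon.
From Coquelicot Require Import Coquelicot.
Open Scope R_scope.

(** * Derivatives along a map *)

(** The series in z converges only for |z| < 1, whereas |1 - e^{i eps t}| = 2 sin(t/2) exceeds 1 as
    soon as t > PI/3: the arc leaves the disc on which [is_mpl] gives explicit values. The
    coordinate comes from kappa w = 1 - ((1-w)/(1+w))^2. The Cayley map sends the disc to the right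
    half-plane, and squaring opens it to the plane slit along (-oo,0]. On the arc (1-w)/(1+w) has to
    be the square root e^{i eps t/2} of e^{i eps t}, whence w = - i eps tan(t/4), and t < PI says
    tan(t/4) < 1.

    The factor (- i eps)^n originates in dz/(1-z), which on the arc is - i eps dt: each of the n
    blocks contributes one such constant, and the iterated integral is the inverse constant (i
    eps)^n times the polylogarithm.

    Two parallel families of coefficients are kept: one in z, identified with [mpl_coef], and one in
    w, compared with the first only for |w| < 1/8, where the series in z converge as well. *)

Definition deriv_along {X : Type} (i f : X -> C) (x : X) (l : C) : Prop :=
  forall eps : R, 0 < eps -> exists d : R, 0 < d /\ forall y : X,
    Cmod (i y - i x) < d ->
    Cmod (f y - f x - l * (i y - i x)) <= eps * Cmod (i y - i x).

(** Two instances of one notion: [cderiv] is complex differentiability, [rderiv] the derivative of a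
    curve in the plane. Proving the rules for an arbitrary map [i] serves both, and
    [deriv_along_comp] also covers a holomorphic function along a curve. *)
Notation cderiv := (deriv_along (X := C) (fun z => z)).
Notation rderiv := (deriv_along RtoC).

Section DerivRules.
Context {X : Type} (i : X -> C).

Lemma deriv_along_ext (f g : X -> C) x l :
  (forall y, f y = g y) -> deriv_along i f x l -> deriv_along i g x l.
Proof.
intros E H eps He; destruct (H eps He) as [d [Hd K]]; exists d; split; [easy|].
intros y Hy; rewrite <- !E; now apply K.
Qed.

Lemma deriv_along_ext_loc (f g : X -> C) x l d :
  0 < d -> (forall y, Cmod (i y - i x) < d -> f y = g y) ->
  deriv_along i f x l -> deriv_along i g x l.
Proof.
intros Hd0 E H eps He; destruct (H eps He) as [d' [Hd K]].
exists (Rmin d d'); split; [now apply Rmin_pos|].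
intros y Hy.
rewrite <- !E.
- apply K. eapply Rlt_le_trans; [exact Hy|apply Rmin_r].
- replace (i x - i x)%C with (RtoC 0) by ring. now rewrite Cmod_0.
- eapply Rlt_le_trans; [exact Hy|apply Rmin_l].
Qed.

Lemma deriv_along_const (c : C) x : deriv_along i (fun _ => c) x 0.
Proof.
intros eps He; exists 1; split; [lra|]. intros y _.
replace (c - c - 0 * (i y - i x))%C with (RtoC 0) by ring.
rewrite Cmod_0; apply Rmult_le_pos; [lra|apply Cmod_ge_0].
Qed.

Lemma deriv_along_id x : deriv_along i i x 1.
Proof.
intros eps He; exists 1; split; [lra|]. intros y _.
replace (i y - i x - 1 * (i y - i x))%C with (RtoC 0) by ring.
rewrite Cmod_0; apply Rmult_le_pos; [lra|apply Cmod_ge_0].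
Qed.

Lemma deriv_along_lip (f : X -> C) x l : deriv_along i f x l ->
  exists d, 0 < d /\ forall y, Cmod (i y - i x) < d ->
    Cmod (f y - f x) <= (Cmod l + 1) * Cmod (i y - i x).
Proof.
intros H; destruct (H 1 Rlt_0_1) as [d [Hd K]]; exists d; split; [easy|].
intros y Hy; specialize (K y Hy).
replace (f y - f x)%C with ((f y - f x - l * (i y - i x)) + l * (i y - i x))%C by ring.
eapply Rle_trans; [apply Cmod_triangle|]. rewrite Cmod_mult. lra.
Qed.

Lemma deriv_along_plus (f g : X -> C) x l m :
  deriv_along i f x l -> deriv_along i g x m ->
  deriv_along i (fun y => f y + g y)%C x (l + m)%C.
Proof.
intros Hf Hg eps He.
destruct (Hf (eps / 2)) as [d1 [Hd1 K1]]; [lra|].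
destruct (Hg (eps / 2)) as [d2 [Hd2 K2]]; [lra|].
exists (Rmin d1 d2); split; [now apply Rmin_pos|].
intros y Hy.
specialize (K1 y (Rlt_le_trans _ _ _ Hy (Rmin_l _ _))).
specialize (K2 y (Rlt_le_trans _ _ _ Hy (Rmin_r _ _))).
replace (f y + g y - (f x + g x) - (l + m) * (i y - i x))%C
  with ((f y - f x - l * (i y - i x)) + (g y - g x - m * (i y - i x)))%C by ring.
eapply Rle_trans; [apply Cmod_triangle|]. lra.
Qed.

Lemma deriv_along_mult (f g : X -> C) x l m :
  deriv_along i f x l -> deriv_along i g x m ->
  deriv_along i (fun y => f y * g y)%C x (l * g x + f x * m)%C.
Proof.
intros Hf Hg eps He.
destruct (deriv_along_lip _ _ _ Hf) as [d3 [Hd3 K3]].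
destruct (deriv_along_lip _ _ _ Hg) as [d4 [Hd4 K4]].
assert (Hp : 0 <= Cmod (f x)) by apply Cmod_ge_0.
assert (Hq : 0 <= Cmod (g x)) by apply Cmod_ge_0.
assert (Hl : 0 <= Cmod l) by apply Cmod_ge_0.
assert (Hm : 0 <= Cmod m) by apply Cmod_ge_0.
destruct (Hf (eps / 3 / (Cmod (g x) + 1))) as [d1 [Hd1 K1]].
{ apply Rdiv_lt_0_compat; lra. }
destruct (Hg (eps / 3 / (Cmod (f x) + 1))) as [d2 [Hd2 K2]].
{ apply Rdiv_lt_0_compat; lra. }
set (d5 := eps / 3 / ((Cmod l + 1) * (Cmod m + 1))).
assert (Hd5 : 0 < d5).
{ apply Rdiv_lt_0_compat; [lra|]. apply Rmult_lt_0_compat; lra. }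
exists (Rmin (Rmin d1 d2) (Rmin (Rmin d3 d4) d5)); split.
{ repeat apply Rmin_pos; easy. }
intros y Hy.
assert (Hy1 := Rlt_le_trans _ _ _ Hy (Rmin_l _ _)).
assert (Hy2 := Rlt_le_trans _ _ _ Hy (Rmin_r _ _)).
assert (Hy3 := Rlt_le_trans _ _ _ Hy2 (Rmin_l _ _)).
specialize (K1 y (Rlt_le_trans _ _ _ Hy1 (Rmin_l _ _))).
specialize (K2 y (Rlt_le_trans _ _ _ Hy1 (Rmin_r _ _))).
specialize (K3 y (Rlt_le_trans _ _ _ Hy3 (Rmin_l _ _))).
specialize (K4 y (Rlt_le_trans _ _ _ Hy3 (Rmin_r _ _))).
assert (Hy5 := Rlt_le_trans _ _ _ Hy2 (Rmin_r _ _)).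
set (h := (i y - i x)%C) in *.
assert (Hh : 0 <= Cmod h) by apply Cmod_ge_0.
replace (f y * g y - f x * g x - (l * g x + f x * m) * h)%C
  with ((f y - f x - l * h) * g x + f x * (g y - g x - m * h)
        + (f y - f x) * (g y - g x))%C by ring.
eapply Rle_trans; [apply Cmod_triangle|].
eapply Rle_trans; [apply Rplus_le_compat_r, Cmod_triangle|].
rewrite !Cmod_mult.
assert (T1 : Cmod (f y - f x - l * h) * Cmod (g x) <= eps / 3 * Cmod h).
{ apply Rle_trans with (eps / 3 / (Cmod (g x) + 1) * Cmod h * (Cmod (g x) + 1)).
  - apply Rmult_le_compat; try apply Cmod_ge_0; lra.
  - right; field; lra. }
assert (T2 : Cmod (f x) * Cmod (g y - g x - m * h) <= eps / 3 * Cmod h).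
{ apply Rle_trans with ((Cmod (f x) + 1) * (eps / 3 / (Cmod (f x) + 1) * Cmod h)).
  - apply Rmult_le_compat; try apply Cmod_ge_0; lra.
  - right; field; lra. }
assert (T3 : Cmod (f y - f x) * Cmod (g y - g x) <= eps / 3 * Cmod h).
{ apply Rle_trans with (((Cmod l + 1) * Cmod h) * ((Cmod m + 1) * d5)).
  - apply Rmult_le_compat; try apply Cmod_ge_0; [easy|].
    eapply Rle_trans; [exact K4|]. apply Rmult_le_compat_l; lra.
  - right; unfold d5; field; split; lra. }
lra.
Qed.

Lemma deriv_along_comp (f : C -> C) (g : X -> C) x l m :
  cderiv f (g x) l -> deriv_along i g x m ->
  deriv_along i (fun y => f (g y)) x (l * m)%C.
Proof.
intros Hf Hg eps He.
destruct (deriv_along_lip _ _ _ Hg) as [d4 [Hd4 K4]].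
assert (Hl : 0 <= Cmod l) by apply Cmod_ge_0.
assert (Hm : 0 <= Cmod m) by apply Cmod_ge_0.
destruct (Hf (eps / 2 / (Cmod m + 1))) as [d1 [Hd1 K1]].
{ apply Rdiv_lt_0_compat; lra. }
destruct (Hg (eps / 2 / (Cmod l + 1))) as [d2 [Hd2 K2]].
{ apply Rdiv_lt_0_compat; lra. }
assert (Hd5 : 0 < d1 / (Cmod m + 1)).
{ apply Rdiv_lt_0_compat; lra. }
exists (Rmin (Rmin d4 d2) (d1 / (Cmod m + 1))); split.
{ repeat apply Rmin_pos; easy. }
intros y Hy.
assert (Hy1 := Rlt_le_trans _ _ _ Hy (Rmin_l _ _)).
assert (Hy2 := Rlt_le_trans _ _ _ Hy (Rmin_r _ _)).
specialize (K4 y (Rlt_le_trans _ _ _ Hy1 (Rmin_l _ _))).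
specialize (K2 y (Rlt_le_trans _ _ _ Hy1 (Rmin_r _ _))).
set (h := (i y - i x)%C) in *.
assert (Hh : 0 <= Cmod h) by apply Cmod_ge_0.
specialize (K1 (g y)). cbv beta in K1.
assert (K1' : Cmod (g y - g x) < d1).
{ eapply Rle_lt_trans; [exact K4|].
  apply Rlt_le_trans with ((Cmod m + 1) * (d1 / (Cmod m + 1))).
  - apply Rmult_lt_compat_l; lra.
  - right; field; lra. }
specialize (K1 K1').
replace (f (g y) - f (g x) - l * m * h)%C
  with ((f (g y) - f (g x) - l * (g y - g x)) + l * (g y - g x - m * h))%C by ring.
eapply Rle_trans; [apply Cmod_triangle|].
rewrite Cmod_mult.
assert (T1 : Cmod (f (g y) - f (g x) - l * (g y - g x)) <= eps / 2 * Cmod h).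
{ eapply Rle_trans; [exact K1|].
  apply Rle_trans with (eps / 2 / (Cmod m + 1) * ((Cmod m + 1) * Cmod h)).
  - apply Rmult_le_compat_l; [|easy]. left; apply Rdiv_lt_0_compat; lra.
  - right; field; lra. }
assert (T2 : Cmod l * Cmod (g y - g x - m * h) <= eps / 2 * Cmod h).
{ apply Rle_trans with ((Cmod l + 1) * (eps / 2 / (Cmod l + 1) * Cmod h)).
  - apply Rmult_le_compat; try apply Cmod_ge_0; lra.
  - right; field; lra. }
lra.
Qed.

Lemma deriv_along_scal (c : C) (f : X -> C) x l :
  deriv_along i f x l -> deriv_along i (fun y => c * f y)%C x (c * l)%C.
Proof.
intros H. replace (c * l)%C with (0 * f x + c * l)%C by ring.
apply (deriv_along_mult (fun _ => c)); [apply deriv_along_const|easy].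
Qed.

Lemma deriv_along_minus (f g : X -> C) x l m :
  deriv_along i f x l -> deriv_along i g x m ->
  deriv_along i (fun y => f y - g y)%C x (l - m)%C.
Proof.
intros Hf Hg. unfold Cminus.
replace (- m)%C with (- (1) * m)%C by ring.
apply deriv_along_ext with (fun y => f y + (- (1)) * g y)%C; [intros y; unfold Cminus; ring|].
apply deriv_along_plus; [easy|].
now apply deriv_along_scal.
Qed.

Lemma deriv_along_pow (f : X -> C) x l n :
  deriv_along i f x l ->
  deriv_along i (fun y => f y ^ S n)%C x (RtoC (INR (S n)) * f x ^ n * l)%C.
Proof.
intros H; induction n as [|n IH].
- apply deriv_along_ext with f; [intros y; simpl; ring|].
  simpl. now replace (1 * 1 * l)%C with l by ring.
- apply deriv_along_ext with (fun y => f y * f y ^ S n)%C; [intros y; reflexivity|].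
  replace (RtoC (INR (S (S n))) * f x ^ S n * l)%C
    with (l * f x ^ S n + f x * (RtoC (INR (S n)) * f x ^ n * l))%C.
  + now apply deriv_along_mult.
  + rewrite (S_INR (S n)), RtoC_plus. simpl (_ ^ S n)%C. ring.
Qed.

End DerivRules.

Lemma cderiv_inv (z : C) : z <> 0 -> cderiv Cinv z (- / (z * z))%C.
Proof.
intros Hz eps He.
assert (Hz' := proj1 (Cmod_gt_0 z) Hz).
set (r := Cmod z) in *.
assert (Hr3 : 0 < eps * (r * r * r) / 2).
{ apply Rdiv_lt_0_compat; [|lra]. repeat apply Rmult_lt_0_compat; lra. }
(* For |w - z| < r/2 one has |w| >= r/2, so the remainder (w-z)^2/(w z^2) is at most 2|w-z|^2/r^3;
   the second bound turns this into eps |w-z|. *)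
exists (Rmin (r / 2) (eps * (r * r * r) / 2)); split; [apply Rmin_pos; lra|].
intros w Hw.
assert (H1 := Rlt_le_trans _ _ _ Hw (Rmin_l _ _)).
assert (H2 := Rlt_le_trans _ _ _ Hw (Rmin_r _ _)).
assert (Hm : r / 2 <= Cmod w).
{ assert (r <= Cmod w + Cmod (w - z)); [|lra].
  unfold r; replace z with (w + - (w - z))%C at 1 by ring.
  eapply Rle_trans; [apply Cmod_triangle|]. rewrite Cmod_opp; lra. }
assert (Hw0 : w <> 0).
{ apply Cmod_gt_0; lra. }
replace (/ w - / z - - / (z * z) * (w - z))%C
  with ((w - z) * (w - z) / (w * (z * z)))%C by (field; now split).
rewrite Cmod_div, !Cmod_mult.
2:{ repeat apply Cmult_neq_0; easy. }
fold r. set (h := Cmod (w - z)) in *.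
assert (Hh : 0 <= h) by apply Cmod_ge_0.
apply Rle_trans with (h * (eps * (r * r * r) / 2) / (r / 2 * (r * r))).
- unfold Rdiv at 1 3. apply Rmult_le_compat.
  + now apply Rmult_le_pos.
  + left; apply Rinv_0_lt_compat. repeat apply Rmult_lt_0_compat; lra.
  + apply Rmult_le_compat_l; lra.
  + apply Rinv_le_contravar. { repeat apply Rmult_lt_0_compat; lra. }
    apply Rmult_le_compat_r; [|easy]. apply Rmult_le_pos; lra.
- right; field; lra.
Qed.

Lemma cderiv_div (f g : C -> C) z l m : g z <> 0 -> cderiv f z l -> cderiv g z m ->
  cderiv (fun w => f w / g w)%C z ((l * g z - f z * m) / (g z * g z))%C.
Proof.
intros Hg Hf Hm.
replace ((l * g z - f z * m) / (g z * g z))%C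
  with (l * / g z + f z * (- / (g z * g z) * m))%C by (field; easy).
apply (deriv_along_mult _ f (fun w => / g w)%C); [easy|].
apply (deriv_along_comp _ Cinv g); [now apply cderiv_inv|easy].
Qed.

(** * Passage to and from the derivatives of Coquelicot *)

Lemma cderiv_is_derive (f : C -> C) (z l : C) :
  is_derive (K := C_AbsRing) (V := C_NormedModule) f z l <-> cderiv f z l.
Proof.
split.
- intros [_ H] eps He.
  specialize (H z (fun P K => K) (mkposreal eps He)).
  destruct H as [d Hd]. exists d; split; [apply d|].
  intros w Hw. specialize (Hd w Hw). simpl in Hd.
  change (Cmod ((f w - f z) - (w - z) * l) <= eps * Cmod (w - z)) in Hd.
  now rewrite (Cmult_comm l).
- intros H. split; [apply is_linear_scal_l|].
  intros x Hx eps.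
  rewrite <- (is_filter_lim_locally_unique _ _ Hx). clear x Hx.
  destruct (H eps (cond_pos eps)) as [d [Hd K]].
  exists (mkposreal d Hd). intros w Hw.
  specialize (K w Hw).
  change (Cmod ((f w - f z) - (w - z) * l) <= eps * Cmod (w - z)).
  now rewrite (Cmult_comm _ l).
Qed.

Lemma rderiv_is_derive (f : R -> C) (t : R) (l : C) :
  is_derive (K := R_AbsRing) (V := C_R_NormedModule) f t l <-> rderiv f t l.
Proof.
assert (E : forall u, Cmod (RtoC u - RtoC t) = Rabs (u - t)).
{ intros u; now rewrite <- RtoC_minus, Cmod_R. }
split.
- intros [_ H] eps He.
  specialize (H t (fun P K => K) (mkposreal eps He)).
  destruct H as [d Hd]. exists d; split; [apply d|].
  intros u Hu. rewrite E in *. specialize (Hd u Hu). simpl in Hd.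
  change (norm (minus u t)) with (Rabs (u - t)) in Hd.
  rewrite <- Cmod_norm in Hd. rewrite scal_R_Cmult in Hd.
  change (minus u t) with (u - t) in Hd. rewrite RtoC_minus in Hd.
  rewrite (Cmult_comm l). exact Hd.
- intros H. split; [apply is_linear_scal_l|].
  intros x Hx eps.
  rewrite <- (is_filter_lim_locally_unique _ _ Hx). clear x Hx.
  destruct (H eps (cond_pos eps)) as [d [Hd K]].
  exists (mkposreal d Hd). intros u Hu.
  specialize (K u). rewrite E in K. specialize (K Hu).
  change (norm (minus u t)) with (Rabs (u - t)).
  rewrite <- Cmod_norm, scal_R_Cmult.
  change (minus u t) with (u - t). rewrite RtoC_minus.
  rewrite (Cmult_comm l) in K. exact K.
Qed.

Lemma rderiv_pair (f g : R -> R) (t a b : R) :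
  is_derive f t a -> is_derive g t b -> rderiv (fun s => (f s, g s)) t (a, b).
Proof.
assert (HR : forall (f : R -> R) a, is_derive f t a -> rderiv (fun s => RtoC (f s)) t a).
{ clear; intros f a [_ H] eps He.
  specialize (H t (fun P K => K) (mkposreal eps He)).
  destruct H as [d Hd]. exists d; split; [apply d|].
  intros u Hu. rewrite <- RtoC_minus, Cmod_R in Hu.
  specialize (Hd u Hu).
  rewrite <- !RtoC_minus, <- RtoC_mult, <- RtoC_minus, !Cmod_R.
  rewrite (Rmult_comm a). exact Hd. }
intros Hf Hg.
apply deriv_along_ext with (fun s => RtoC (f s) + Ci * RtoC (g s))%C.
{ intros s; unfold Cplus, Cmult, Ci, RtoC; simpl; f_equal; ring. }
replace (a, b) with (RtoC a + Ci * RtoC b)%C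
  by (unfold Cplus, Cmult, Ci, RtoC; simpl; f_equal; ring).
apply deriv_along_plus; [|apply deriv_along_scal]; now apply HR.
Qed.

Lemma rderiv_continuous (f : R -> C) (t : R) (l : C) :
  rderiv f t l -> continuous (U := C_R_NormedModule) f t.
Proof.
intros H. apply (ex_derive_continuous (K := R_AbsRing) (V := C_R_NormedModule)).
exists l. now apply rderiv_is_derive.
Qed.

(** * Goursat's lemma on rectangles *)

Notation CInt := (RInt (V := C_R_CompleteNormedModule)).
Notation is_CInt := (is_RInt (V := C_R_NormedModule)).
Notation ex_CInt := (ex_RInt (V := C_R_NormedModule)).

Lemma Cmod_le_abs (a b : R) : Cmod (a, b) <= Rabs a + Rabs b.
Proof.
replace ((a, b) : C) with (RtoC a + Ci * RtoC b)%C
  by (unfold Cplus, Cmult, Ci, RtoC; simpl; f_equal; ring).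
eapply Rle_trans; [apply Cmod_triangle|].
rewrite Cmod_mult, Cmod_Ci, !Cmod_R; lra.
Qed.

Lemma rderiv_hor (f : C -> C) (x y : R) l : cderiv f (x, y) l ->
  rderiv (fun u => f (u, y)) x l.
Proof.
intros H. replace l with (l * 1)%C by ring.
apply (deriv_along_comp RtoC f (fun u => (u, y))); [exact H|].
apply (rderiv_pair (fun u => u) (fun _ => y)).
- apply (is_derive_id (K := R_AbsRing)).
- apply (is_derive_const (K := R_AbsRing) (V := R_NormedModule)).
Qed.

Lemma rderiv_ver (f : C -> C) (x y : R) l : cderiv f (x, y) l ->
  rderiv (fun v => f (x, v)) y (l * Ci)%C.
Proof.
intros H.
apply (deriv_along_comp RtoC f (fun v => (x, v))); [exact H|].
apply (rderiv_pair (fun _ => x) (fun v => v)).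
- apply (is_derive_const (K := R_AbsRing) (V := R_NormedModule)).
- apply (is_derive_id (K := R_AbsRing)).
Qed.

Lemma ex_CInt_rderiv (f : R -> C) a b : a <= b ->
  (forall t, a <= t <= b -> exists l, rderiv f t l) -> ex_CInt f a b.
Proof.
intros Hab H.
apply (ex_RInt_continuous (V := C_R_CompleteNormedModule)).
rewrite Rmin_left, Rmax_right; try easy.
intros t Ht. destruct (H t Ht) as [l Hl].
exact (rderiv_continuous f t l Hl).
Qed.

Lemma is_CInt_rderiv (f df : R -> C) a b : a <= b ->
  (forall t, a <= t <= b -> rderiv f t (df t)) ->
  (forall t, a <= t <= b -> exists l, rderiv df t l) ->
  is_CInt df a b (f b - f a)%C.
Proof.
intros Hab H1 H2.
apply (is_RInt_derive (V := C_R_CompleteNormedModule));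
  rewrite Rmin_left, Rmax_right; try easy; intros t Ht.
- apply rderiv_is_derive; now apply H1.
- destruct (H2 t Ht) as [l Hl]. exact (rderiv_continuous df t l Hl).
Qed.

Lemma CInt_bound (f : R -> C) a b (I : C) M : a <= b ->
  is_CInt f a b I -> (forall t, a <= t <= b -> Cmod (f t) <= M) ->
  Cmod I <= M * (b - a).
Proof.
intros Hab HI HM.
rewrite Cmod_norm.
apply (norm_RInt_le (V := C_R_NormedModule) f (fun _ => M) a b); try easy.
- intros t Ht. rewrite <- Cmod_norm. now apply HM.
- replace (M * (b - a)) with (scal (b - a) M) by (unfold scal; simpl; unfold mult; simpl; ring).
  apply (is_RInt_const (V := R_NormedModule)).
Qed.

Lemma CInt_close (g h H : R -> C) a b I M : a <= b ->
  is_CInt g a b I ->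
  (forall t, a <= t <= b -> rderiv H t (h t)) ->
  (forall t, a <= t <= b -> exists l, rderiv h t l) ->
  (forall t, a <= t <= b -> Cmod (g t - h t) <= M) ->
  Cmod (I - (H b - H a)) <= M * (b - a).
Proof.
intros Hab Hg HH Hh HM.
apply CInt_bound with (fun t => g t - h t)%C; try easy.
apply (is_RInt_minus (V := C_R_NormedModule)); [easy|].
now apply is_CInt_rderiv.
Qed.

(** The contour integral of f dz along the boundary of the rectangle, anticlockwise; dz = i dv on
    the vertical sides. *)
Definition rect_int (f : C -> C) (x1 x2 y1 y2 : R) : C :=
  (CInt (fun u => f (u, y1)) x1 x2 - CInt (fun u => f (u, y2)) x1 x2
   + Ci * CInt (fun v => f (x2, v)) y1 y2 - Ci * CInt (fun v => f (x1, v)) y1 y2)%C.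

Section Goursat.
Variables (f : C -> C) (a a' b b' : R).
Hypothesis Hf : forall x y, a <= x <= a' -> b <= y <= b' -> exists l, cderiv f (x, y) l.

Lemma ex_CInt_hor y x1 x2 : a <= x1 -> x1 <= x2 -> x2 <= a' -> b <= y <= b' ->
  ex_CInt (fun u => f (u, y)) x1 x2.
Proof.
intros H1 H2 H3 Hy. apply ex_CInt_rderiv; [easy|]. intros t Ht.
destruct (Hf t y) as [l Hl]; [lra|easy|]. exists l; now apply rderiv_hor.
Qed.

Lemma ex_CInt_ver x y1 y2 : b <= y1 -> y1 <= y2 -> y2 <= b' -> a <= x <= a' ->
  ex_CInt (fun v => f (x, v)) y1 y2.
Proof.
intros H1 H2 H3 Hy. apply ex_CInt_rderiv; [easy|]. intros t Ht.
destruct (Hf x t) as [l Hl]; [easy|lra|]. exists (l * Ci)%C; now apply rderiv_ver.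
Qed.

Lemma rect_int_split x1 x2 x3 y1 y2 y3 :
  a <= x1 -> x1 <= x2 -> x2 <= x3 -> x3 <= a' ->
  b <= y1 -> y1 <= y2 -> y2 <= y3 -> y3 <= b' ->
  rect_int f x1 x3 y1 y3 =
  (rect_int f x1 x2 y1 y2 + rect_int f x2 x3 y1 y2
   + rect_int f x1 x2 y2 y3 + rect_int f x2 x3 y2 y3)%C.
Proof.
intros. unfold rect_int.
assert (EH : forall y, b <= y <= b' -> CInt (fun u => f (u, y)) x1 x3
  = (CInt (fun u => f (u, y)) x1 x2 + CInt (fun u => f (u, y)) x2 x3)%C).
{ intros y Hy; symmetry. apply (RInt_Chasles (V := C_R_CompleteNormedModule));
  apply ex_CInt_hor; lra. }
assert (EV : forall x, a <= x <= a' -> CInt (fun v => f (x, v)) y1 y3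
  = (CInt (fun v => f (x, v)) y1 y2 + CInt (fun v => f (x, v)) y2 y3)%C).
{ intros y Hy; symmetry. apply (RInt_Chasles (V := C_R_CompleteNormedModule));
  apply ex_CInt_ver; lra. }
rewrite !EH, !EV by lra. ring.
Qed.

(** An affine function has a polynomial primitive, so its contour integral vanishes; what remains is
    the error, at most M on each of the four sides. *)
Lemma rect_int_small (p alpha beta : C) x1 x2 y1 y2 M :
  a <= x1 -> x1 <= x2 -> x2 <= a' -> b <= y1 -> y1 <= y2 -> y2 <= b' ->
  (forall x y, x1 <= x <= x2 -> y1 <= y <= y2 ->
     Cmod (f (x, y) - (alpha + beta * ((x, y) - p))) <= M) ->
  Cmod (rect_int f x1 x2 y1 y2) <= 2 * M * ((x2 - x1) + (y2 - y1)).
Proof.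
intros Hx1 Hx Hx2 Hy1 Hy Hy2 HM.
set (A := fun z : C => (alpha + beta * (z - p))%C).
set (B := fun z : C => (alpha * z + beta / 2 * ((z - p) ^ 2))%C).
assert (DA : forall z, cderiv A z beta).
{ intros z. replace beta with (0 + beta * (1 - 0))%C by ring.
  apply deriv_along_plus; [apply deriv_along_const|].
  apply deriv_along_scal, deriv_along_minus;
    [apply deriv_along_id|apply deriv_along_const]. }
assert (DB : forall z, cderiv B z (A z)).
{ intros z. unfold A.
  replace (alpha + beta * (z - p))%C
    with (alpha * 1 + beta / 2 * (RtoC (INR 2) * (z - p) ^ 1 * (1 - 0)))%C.
  2:{ simpl. replace (1 + 1) with 2 by ring. field. }
  apply deriv_along_plus; [apply deriv_along_scal, deriv_along_id|].
  apply deriv_along_scal, (deriv_along_pow _ (fun z => z - p)%C _ _ 1), deriv_along_minus;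
    [apply deriv_along_id|apply deriv_along_const]. }
assert (EH : forall y, y1 <= y <= y2 ->
  Cmod (CInt (fun u => f (u, y)) x1 x2 - (B (x2, y) - B (x1, y))) <= M * (x2 - x1)).
{ intros y Hyy.
  apply (CInt_close (fun u => f (u, y)) (fun u => A (u, y)) (fun u => B (u, y))); try easy.
  - apply (RInt_correct (V := C_R_CompleteNormedModule)), ex_CInt_hor; lra.
  - intros t _; now apply rderiv_hor.
  - intros t _; exists beta; now apply rderiv_hor.
  - intros t Ht; now apply HM. }
assert (EV : forall x, x1 <= x <= x2 ->
  Cmod (Ci * CInt (fun v => f (x, v)) y1 y2 - (B (x, y2) - B (x, y1))) <= M * (y2 - y1)).
{ intros x Hxx.
  (* Since d/dv B(x,v) = i A(x,v), a primitive of A(x,v) in v is - i B(x,v). *)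
  replace (Ci * CInt (fun v => f (x, v)) y1 y2 - (B (x, y2) - B (x, y1)))%C
    with (Ci * (CInt (fun v => f (x, v)) y1 y2
                - (- Ci * B (x, y2) - - Ci * B (x, y1))))%C.
  2:{ assert (E : (Ci * Ci = - (1))%C).
      { unfold Cmult, Ci, Copp, RtoC; simpl; f_equal; ring. }
      ring [E]. }
  rewrite Cmod_mult, Cmod_Ci, Rmult_1_l.
  apply (CInt_close (fun v => f (x, v)) (fun v => A (x, v)) (fun v => (- Ci * B (x, v))%C)); try easy.
  - apply (RInt_correct (V := C_R_CompleteNormedModule)), ex_CInt_ver; lra.
  - intros t _. replace (A (x, t)) with (- Ci * (A (x, t) * Ci))%C.
    + apply deriv_along_scal. now apply rderiv_ver.
    + assert (E : (Ci * Ci = - (1))%C).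
      { unfold Cmult, Ci, Copp, RtoC; simpl; f_equal; ring. }
      ring [E].
  - intros t _; exists (beta * Ci)%C; now apply rderiv_ver.
  - intros t Ht; now apply HM. }
unfold rect_int.
assert (H1 := EH y1 ltac:(lra)). assert (H2 := EH y2 ltac:(lra)).
assert (H3 := EV x1 ltac:(lra)). assert (H4 := EV x2 ltac:(lra)).
match type of H1 with Cmod ?e <= _ => set (e1 := e) in * end.
match type of H2 with Cmod ?e <= _ => set (e2 := e) in * end.
match type of H3 with Cmod ?e <= _ => set (e3 := e) in * end.
match type of H4 with Cmod ?e <= _ => set (e4 := e) in * end.
match goal with |- Cmod ?e <= _ => replace e with ((e1 - e2) + (e4 - e3))%C end.
2:{ unfold e1, e2, e3, e4; ring. }
assert (TM : forall u v : C, Cmod (u - v) <= Cmod u + Cmod v).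
{ intros u v. rewrite <- (Cmod_opp v). apply Cmod_triangle. }
eapply Rle_trans; [apply Cmod_triangle|].
assert (T1 := TM e1 e2). assert (T2 := TM e4 e3). lra.
Qed.

End Goursat.

(** The point is the supremum of the left endpoints, each of which lies below every right endpoint.
    It is applied to abscissas and ordinates separately. *)
Lemma nested_intervals (x s : nat -> R) :
  (forall n, 0 <= s n) ->
  (forall n, x n <= x (S n) /\ x (S n) + s (S n) <= x n + s n) ->
  exists l, forall n, x n <= l <= x n + s n.
Proof.
intros Hs H.
assert (Hm : forall n m, x n <= x (n + m)%nat /\ x (n + m)%nat + s (n + m)%nat <= x n + s n).
{ intros n m; induction m as [|m IH].
  - rewrite Nat.add_0_r; lra.
  - rewrite Nat.add_succ_r. specialize (H (n + m)%nat). lra. }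
assert (Hb : forall n m, x n <= x m + s m).
{ intros n m. destruct (Nat.le_ge_cases n m) as [L|L].
  - destruct (Hm n (m - n)%nat) as [H1 _]. replace (n + (m - n))%nat with m in H1 by lia.
    specialize (Hs m); lra.
  - destruct (Hm m (n - m)%nat) as [_ H1]. replace (m + (n - m))%nat with n in H1 by lia.
    specialize (Hs n); lra. }
destruct (completeness (fun r => exists n, r = x n)) as [l [Hl1 Hl2]].
- exists (x O + s O). intros r [n ->]. apply Hb.
- exists (x O); now exists O.
- exists l. intros n; split.
  + apply Hl1; now exists n.
  + apply Hl2. intros r [m ->]. apply Hb.
Qed.

(** Bisection: a nonzero integral is handed down to nested quarters on which it stays larger than
    eps (s n + t n)^2, a threshold divided by 4 at each step. At the common point differentiability
    gives an affine approximation, and [rect_int_small] bounds the integral by half that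
    threshold. *)
Theorem goursat_rectangle (f : C -> C) (a a' b b' : R) : a < a' -> b < b' ->
  (forall x y, a <= x <= a' -> b <= y <= b' -> exists l, cderiv f (x, y) l) ->
  rect_int f a a' b b' = 0.
Proof.
intros Ha Hb Hf.
set (s := fun n : nat => (a' - a) / 2 ^ n).
set (t := fun n : nat => (b' - b) / 2 ^ n).
assert (P2 : forall n, 0 < 2 ^ n) by (intros n; apply pow_lt; lra).
assert (Hs : forall n, 0 < s n) by (intros n; apply Rdiv_lt_0_compat; [lra|easy]).
assert (Ht : forall n, 0 < t n) by (intros n; apply Rdiv_lt_0_compat; [lra|easy]).
assert (Hs2 : forall n, s n = s (S n) + s (S n)).
{ intros n; unfold s; simpl. specialize (P2 n). field; lra. }
assert (Ht2 : forall n, t n = t (S n) + t (S n)).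
{ intros n; unfold t; simpl. specialize (P2 n). field; lra. }
apply Cmod_eq_0, Rle_antisym; [|apply Cmod_ge_0].
apply Rnot_lt_le; intros Hpos.
(* Half of the initial modulus, so that the strict inequality in [good] holds at stage 0. *)
set (eps := Cmod (rect_int f a a' b b') / 2 / (s O + t O) ^ 2).
assert (H0 : 0 < (s O + t O) ^ 2).
{ specialize (Hs O); specialize (Ht O). apply pow_lt; lra. }
assert (Heps : 0 < eps) by (unfold eps; repeat apply Rdiv_lt_0_compat; lra).
set (good := fun (n : nat) (q : R * R) =>
  (a <= fst q /\ fst q + s n <= a' /\ b <= snd q /\ snd q + t n <= b') /\
  eps * (s n + t n) ^ 2
    < Cmod (rect_int f (fst q) (fst q + s n) (snd q) (snd q + t n))).
set (sub := fun (n : nat) (q q' : R * R) =>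
  (fst q <= fst q' /\ fst q' + s (S n) <= fst q + s n) /\
  (snd q <= snd q' /\ snd q' + t (S n) <= snd q + t n)).
assert (Hstep : forall n q, good n q -> exists q', good (S n) q' /\ sub n q q').
{ intros n [x y] [Hin Hbad]. simpl in Hin, Hbad.
  assert (Sn := Hs (S n)). assert (Tn := Ht (S n)).
  assert (E := Hs2 n). assert (E' := Ht2 n).
  destruct (Rlt_le_dec (eps * (s (S n) + t (S n)) ^ 2)
    (Cmod (rect_int f x (x + s (S n)) y (y + t (S n))))) as [L1|L1].
  { exists (x, y). split; [split; [simpl; lra|exact L1]|unfold sub; simpl; lra]. }
  destruct (Rlt_le_dec (eps * (s (S n) + t (S n)) ^ 2)
    (Cmod (rect_int f (x + s (S n)) (x + s (S n) + s (S n)) y (y + t (S n))))) as [L2|L2].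
  { exists (x + s (S n), y). split; [split; [simpl; lra|exact L2]|unfold sub; simpl; lra]. }
  destruct (Rlt_le_dec (eps * (s (S n) + t (S n)) ^ 2)
    (Cmod (rect_int f x (x + s (S n)) (y + t (S n)) (y + t (S n) + t (S n))))) as [L3|L3].
  { exists (x, y + t (S n)). split; [split; [simpl; lra|exact L3]|unfold sub; simpl; lra]. }
  destruct (Rlt_le_dec (eps * (s (S n) + t (S n)) ^ 2)
    (Cmod (rect_int f (x + s (S n)) (x + s (S n) + s (S n))
             (y + t (S n)) (y + t (S n) + t (S n))))) as [L4|L4].
  { exists (x + s (S n), y + t (S n)).
    split; [split; [simpl; lra|exact L4]|unfold sub; simpl; lra]. }
  exfalso.
  rewrite (rect_int_split f a a' b b' Hf x (x + s (S n)) (x + s n)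
             y (y + t (S n)) (y + t n)) in Hbad by lra.
  rewrite E, E', <- !Rplus_assoc in Hbad.
  match type of Hbad with _ < Cmod (?p + ?q + ?r + ?u)%C =>
    assert (T1 := Cmod_triangle (p + q + r) u);
    assert (T2 := Cmod_triangle (p + q) r);
    assert (T3 := Cmod_triangle p q) end.
  replace (eps * (s (S n) + s (S n) + t (S n) + t (S n)) ^ 2)
    with (4 * (eps * (s (S n) + t (S n)) ^ 2)) in Hbad by ring.
  lra. }
assert (G0 : good O (a, b)).
{ unfold good; simpl. replace (s O) with (a' - a) by (unfold s; simpl; field).
  replace (t O) with (b' - b) by (unfold t; simpl; field). split; [lra|].
  replace (a + (a' - a)) with a' by ring. replace (b + (b' - b)) with b' by ring.
  apply Rle_lt_trans with (eps * (s O + t O) ^ 2).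
  - right; unfold s, t; simpl; field.
  - unfold eps. replace (Cmod (rect_int f a a' b b') / 2 / (s 0%nat + t 0%nat) ^ 2 *
      (s 0%nat + t 0%nat) ^ 2) with (Cmod (rect_int f a a' b b') / 2); [lra|].
    field. intros K; rewrite K in H0; simpl in H0; lra. }
(* Existence of a good quarter is a proposition; indefinite description turns it into a function, so
   that the sequence can be built by recursion. *)
set (next := fun n (p : {q | good n q}) =>
  constructive_indefinite_description _ (Hstep n (proj1_sig p) (proj2_sig p))).
set (q := nat_rect (fun n => {q | good n q}) (exist _ _ G0)
  (fun n p => exist _ (proj1_sig (next n p)) (proj1 (proj2_sig (next n p))))).
set (x := fun n => fst (proj1_sig (q n))). set (y := fun n => snd (proj1_sig (q n))).
assert (Hsub : forall n, sub n (x n, y n) (x (S n), y (S n))).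
{ intros n. unfold x, y. simpl. rewrite <- !surjective_pairing.
  exact (proj2 (proj2_sig (next n (q n)))). }
destruct (nested_intervals x s) as [xi Hxi].
{ intros n; left; apply Hs. } { intros n; apply (Hsub n). }
destruct (nested_intervals y t) as [eta Heta].
{ intros n; left; apply Ht. } { intros n; apply (Hsub n). }
assert (Hg : forall n, good n (x n, y n)).
{ intros n; unfold x, y; rewrite <- surjective_pairing. exact (proj2_sig (q n)). }
clearbody x y. clear q next Hsub G0 Hstep.
destruct (Hf xi eta) as [l Hl].
{ specialize (Hxi O); destruct (Hg O) as [K _]; simpl in K; lra. }
{ specialize (Heta O); destruct (Hg O) as [K _]; simpl in K; lra. }
(* With relative error eps/4 and points at most s N + t N apart, the bound of [rect_int_small] is
   eps (s N + t N)^2 / 2. *)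
destruct (Hl (eps / 4)) as [d [Hd K]]; [lra|].
destruct (archimed_cor1 (d / (s O + t O))) as [N [HN1 HN2]].
{ apply Rdiv_lt_0_compat; [easy|]. specialize (Hs O); specialize (Ht O); lra. }
assert (Hst : s N + t N < d).
{ assert (P := Hs O). assert (P' := Ht O).
  assert (HNpos : 0 < INR N) by (apply lt_0_INR; lia).
  assert (Hpow : INR N <= 2 ^ N).
  { clear. induction N as [|N IH]; [simpl; lra|].
    rewrite S_INR; simpl. assert (1 <= 2 ^ N) by (apply pow_R1_Rle; lra). lra. }
  replace (s N + t N) with ((s O + t O) * / 2 ^ N).
  2:{ unfold s, t; simpl. specialize (P2 N). field; lra. }
  apply Rle_lt_trans with ((s O + t O) * / INR N).
  - apply Rmult_le_compat_l; [lra|]. now apply Rinv_le_contravar.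
  - apply (Rmult_lt_compat_l (s O + t O)) in HN1; [|lra].
    replace ((s 0%nat + t 0%nat) * (d / (s 0%nat + t 0%nat))) with d in HN1 by (field; lra).
    exact HN1. }
destruct (Hg N) as [Hin Hbad]. simpl fst in *. simpl snd in *.
apply (Rlt_irrefl (eps * (s N + t N) ^ 2)).
eapply Rlt_le_trans; [exact Hbad|].
assert (Sn := Hs N). assert (Tn := Ht N).
specialize (Hxi N). specialize (Heta N).
eapply Rle_trans.
- apply (rect_int_small f a a' b b' Hf (xi, eta) (f (xi, eta)) l _ _ _ _
    (eps / 4 * (s N + t N))); try lra.
  intros u v Hu Hv.
  assert (Hm : Cmod ((u, v) - (xi, eta)) <= s N + t N).
  { eapply Rle_trans; [apply Cmod_le_abs|].
    simpl. apply Rplus_le_compat; apply Rabs_le; lra. }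
  eapply Rle_trans; [|apply Rmult_le_compat_l; [lra|exact Hm]].
  replace (f (u, v) - (f (xi, eta) + l * ((u, v) - (xi, eta))))%C
    with (f (u, v) - f (xi, eta) - l * ((u, v) - (xi, eta)))%C by ring.
  apply K. lra.
- replace (x N + s N - x N + (y N + t N - y N)) with (s N + t N) by ring.
  replace (2 * (eps / 4 * (s N + t N)) * (s N + t N))
    with (eps * (s N + t N) ^ 2 / 2) by field.
  assert (0 < eps * (s N + t N) ^ 2); [|lra].
  apply Rmult_lt_0_compat; [easy|]. apply pow_lt; lra.
Qed.

(** * Mean value property and identity theorem on the disc *)

Definition cexp (z : C) : C := (exp (fst z) * cos (snd z), exp (fst z) * sin (snd z)).

Lemma cexp_plus z w : cexp (z + w) = (cexp z * cexp w)%C.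
Proof.
unfold cexp, Cmult, Cplus; simpl. rewrite exp_plus, cos_plus, sin_plus. f_equal; ring.
Qed.

Lemma Cmod_polar (r y : R) : 0 <= r -> Cmod (r * cos y, r * sin y) = r.
Proof.
intros Hr. unfold Cmod; simpl.
replace (r * cos y * (r * cos y * 1) + r * sin y * (r * sin y * 1))
  with (r ^ 2 * (sin y * sin y + cos y * cos y)) by ring.
assert (E := sin2_cos2 y). unfold Rsqr in E. rewrite E, Rmult_1_r. now apply sqrt_pow2.
Qed.

(** From 1 + x <= exp x <= 1/(1-x), where the upper bound is the lower one at -x. *)
Lemma exp_expansion x : Rabs x <= / 2 -> Rabs (exp x - 1 - x) <= 2 * x ^ 2.
Proof.
intros Hx. apply Rabs_le_between in Hx.
assert (H1 := exp_ineq1_le x). assert (H2 := exp_ineq1_le (- x)).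
rewrite exp_Ropp in H2.
assert (H3 : exp x <= / (1 - x)).
{ rewrite <- (Rinv_inv (exp x)). apply Rinv_le_contravar; lra. }
rewrite Rabs_pos_eq by lra.
assert (H4 : / (1 - x) - 1 - x = x ^ 2 / (1 - x)) by (field; lra).
assert (H5 : x ^ 2 / (1 - x) <= x ^ 2 * 2).
{ apply Rmult_le_compat_l; [nra|].
  replace 2 with (/ (/ 2)) by field. apply Rinv_le_contravar; lra. }
lra.
Qed.

Lemma cos_expansion y : Rabs (cos y - 1) <= y ^ 2 / 2.
Proof.
replace y with (2 * (y / 2)) at 1 by field. rewrite cos_2a_sin.
replace (1 - 2 * sin (y / 2) * sin (y / 2) - 1) with (- (2 * (sin (y / 2)) ^ 2)) by ring.
rewrite Rabs_Ropp, Rabs_pos_eq by nra.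
assert (H : (sin (y / 2)) ^ 2 <= (y / 2) ^ 2); [|lra].
rewrite <- !Rsqr_pow2. apply Rsqr_le_abs_1.
assert (B := bounded_variation sin cos 1 0 (y / 2)).
rewrite sin_0, !Rminus_0_r, Rmult_1_l in B. apply B.
intros t _; split; [apply is_derive_Reals, derivable_pt_lim_sin|].
apply Rabs_le, COS_bound.
Qed.

Lemma sin_expansion y : Rabs (sin y - y) <= y ^ 2 / 2 * Rabs y.
Proof.
assert (H := bounded_variation (fun t => sin t - t) (fun t => cos t - 1) (y ^ 2 / 2) 0 y).
cbv beta in H. rewrite sin_0, !Rminus_0_r in H. apply H. intros t Ht. split.
- auto_derive; [easy|ring].
- eapply Rle_trans; [apply cos_expansion|].
  rewrite !Rminus_0_r in Ht. apply Rsqr_le_abs_1 in Ht. rewrite !Rsqr_pow2 in Ht. lra.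
Qed.

(** By [cexp_plus] the question reduces to the origin, where |cexp h - 1 - h| <= 8 |h|^2 follows
    from the three real expansions. *)
Lemma cderiv_cexp (z : C) : cderiv cexp z (cexp z).
Proof.
assert (H0 : forall h, Cmod h <= / 2 -> Cmod (cexp h - 1 - h) <= 8 * Cmod h ^ 2).
{ intros [x y] Hh.
  assert (Hxy := Rmax_Cmod (x, y)). simpl in Hxy.
  assert (Hx := Rle_trans _ _ _ (Rmax_l _ _) Hxy).
  assert (Hy := Rle_trans _ _ _ (Rmax_r _ _) Hxy).
  set (r := Cmod (x, y)) in *.
  assert (X2 : x ^ 2 <= r ^ 2). { rewrite <- (pow2_abs x). now apply pow_incr; split; [apply Rabs_pos|]. }
  assert (Y2 : y ^ 2 <= r ^ 2). { rewrite <- (pow2_abs y). now apply pow_incr; split; [apply Rabs_pos|]. }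
  assert (X1 := exp_expansion x ltac:(lra)).
  assert (C1 := cos_expansion y). assert (S1 := sin_expansion y).
  assert (Hr : 0 <= r) by apply Cmod_ge_0.
  assert (E2 : 0 <= exp x <= 2).
  { split; [left; apply exp_pos|]. apply Rabs_le_between in X1.
    apply Rabs_le_between in Hx. nra. }
  assert (E1 : Rabs (exp x - 1) <= 2 * r).
  { replace (exp x - 1) with ((exp x - 1 - x) + x) by ring.
    eapply Rle_trans; [apply Rabs_triang|]. nra. }
  change (cexp (x, y) - 1 - (x, y))%C
    with (exp x * cos y - 1 - x, exp x * sin y - 0 - y).
  eapply Rle_trans; [apply Cmod_le_abs|].
  replace (exp x * cos y - 1 - x) with (exp x * (cos y - 1) + (exp x - 1 - x)) by ring.
  replace (exp x * sin y - 0 - y) with (exp x * (sin y - y) + (exp x - 1) * y) by ring.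
  assert (A1 := Rabs_triang (exp x * (cos y - 1)) (exp x - 1 - x)).
  assert (A2 := Rabs_triang (exp x * (sin y - y)) ((exp x - 1) * y)).
  rewrite !Rabs_mult in A1. rewrite (Rabs_mult (exp x)), (Rabs_mult (exp x - 1)) in A2. rewrite (Rabs_pos_eq (exp x)) in A1, A2 by lra.
  assert (B1 : exp x * Rabs (cos y - 1) <= 2 * (r ^ 2 / 2)).
  { apply Rmult_le_compat; try lra; apply Rabs_pos. }
  assert (B2 : exp x * Rabs (sin y - y) <= 2 * (r ^ 2 / 2 * 1)).
  { apply Rmult_le_compat; try lra; [apply Rabs_pos|].
    eapply Rle_trans; [exact S1|]. apply Rmult_le_compat; try lra; try apply Rabs_pos. nra. }
  assert (B3 : Rabs (exp x - 1) * Rabs y <= 2 * r * r).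
  { apply Rmult_le_compat; try lra; apply Rabs_pos. }
  assert (R2 := pow2_ge_0 r). replace (2 * r * r) with (2 * r ^ 2) in B3 by ring. lra. }
intros eps He.
assert (HE := Cmod_ge_0 (cexp z)).
assert (Hd : 0 < eps / (8 * (Cmod (cexp z) + 1))) by (apply Rdiv_lt_0_compat; lra).
exists (Rmin (/ 2) (eps / (8 * (Cmod (cexp z) + 1)))); split; [apply Rmin_pos; lra|].
intros w Hw.
assert (H1 := Rlt_le_trans _ _ _ Hw (Rmin_l _ _)).
assert (H2 := Rlt_le_trans _ _ _ Hw (Rmin_r _ _)).
replace w with (z + (w - z))%C at 1 by ring. rewrite cexp_plus.
set (h := (w - z)%C) in *.
replace (cexp z * cexp h - cexp z - cexp z * h)%C with (cexp z * (cexp h - 1 - h))%C by ring.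
rewrite Cmod_mult.
assert (Hh := Cmod_ge_0 h).
apply Rle_trans with ((Cmod (cexp z) + 1) * (8 * Cmod h ^ 2)).
- apply Rmult_le_compat; try apply Cmod_ge_0; [lra|]. apply H0; lra.
- replace ((Cmod (cexp z) + 1) * (8 * Cmod h ^ 2))
    with (8 * (Cmod (cexp z) + 1) * Cmod h * Cmod h) by ring.
  apply Rmult_le_compat_r; [easy|].
  apply Rle_trans with (8 * (Cmod (cexp z) + 1) * (eps / (8 * (Cmod (cexp z) + 1)))).
  + apply Rmult_le_compat_l; lra.
  + right; field; lra.
Qed.

(** The function g(cexp z) has period 2 PI i on Re z < 0, so in Goursat's lemma the horizontal sides
    cancel and the integral over a vertical segment of length 2 PI is the same at every abscissa up
    to ln r. At ln r it is bounded by 2 PI M; far to the left it is close to 2 PI g(0). *)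
Lemma mean_value_bound (g : C -> C) (r M : R) : 0 < r < 1 ->
  (forall z, Cmod z < 1 -> exists l, cderiv g z l) ->
  (forall y, 0 <= y <= 2 * PI -> Cmod (g (r * cos y, r * sin y)) <= M) ->
  Cmod (g 0) <= M.
Proof.
intros Hr Hg HM.
assert (HPI := PI_RGT_0).
set (F := fun z => g (cexp z)).
assert (HF : forall x y, x < 0 -> exists l, cderiv F (x, y) l).
{ intros x y Hx. destruct (Hg (cexp (x, y))) as [l Hl].
  - unfold cexp; simpl. rewrite Cmod_polar by (left; apply exp_pos).
    rewrite <- exp_0. now apply exp_increasing.
  - exists (l * cexp (x, y))%C. apply (deriv_along_comp _ g cexp); [exact Hl|apply cderiv_cexp]. }
assert (Hlr : ln r < 0) by (rewrite <- ln_1; apply ln_increasing; lra).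
assert (EX : forall x, x < 0 -> ex_CInt (fun v => F (x, v)) 0 (2 * PI)).
{ intros x Hx. apply ex_CInt_rderiv; [lra|]. intros v _.
  destruct (HF x v Hx) as [l Hl]. exists (l * Ci)%C. now apply rderiv_ver. }
assert (Hper : forall u, F (u, 2 * PI) = F (u, 0)).
{ intros u; unfold F, cexp; simpl. now rewrite cos_2PI, sin_2PI, cos_0, sin_0. }
assert (EqI : forall x, x < ln r -> CInt (fun v => F (x, v)) 0 (2 * PI)
                                  = CInt (fun v => F (ln r, v)) 0 (2 * PI)).
{ intros x Hx.
  assert (G := goursat_rectangle F x (ln r) 0 (2 * PI) Hx ltac:(lra)
    ltac:(intros; apply HF; lra)).
  unfold rect_int in G.
  rewrite (RInt_ext (V := C_R_CompleteNormedModule) (fun u => F (u, 2 * PI))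
    (fun u => F (u, 0))) in G by (intros; apply Hper).
  set (I1 := CInt (fun v => F (x, v)) 0 (2 * PI)) in *.
  set (I2 := CInt (fun v => F (ln r, v)) 0 (2 * PI)) in *.
  assert (G' : (Ci * (I2 - I1))%C = 0) by (rewrite <- G; ring).
  destruct (Ceq_dec (I2 - I1) 0) as [E|E].
  - apply Ceq_minus in E. now rewrite E.
  - exfalso. apply (Cmult_neq_0 Ci _ Ci_nz E G'). }
assert (HI : Cmod (CInt (fun v => F (ln r, v)) 0 (2 * PI)) <= M * (2 * PI - 0)).
{ apply CInt_bound with (fun v => F (ln r, v)); [lra| |].
  - apply (RInt_correct (V := C_R_CompleteNormedModule)), EX, Hlr.
  - intros t Ht. unfold F, cexp; simpl. rewrite exp_ln by lra. now apply HM. }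
apply le_epsilon. intros eps Heps.
destruct (Hg 0) as [l Hl]; [rewrite Cmod_0; lra|].
destruct (deriv_along_lip _ _ _ _ Hl) as [d [Hd K]].
assert (Hl0 := Cmod_ge_0 l).
(* On the circle of radius m/2 < r the Lipschitz bound keeps g within eps of g(0). *)
set (m := Rmin (Rmin d (eps / (Cmod l + 1))) r).
assert (Hm : 0 < m).
{ unfold m; repeat apply Rmin_pos; try lra. apply Rdiv_lt_0_compat; lra. }
set (x := ln (m / 2)).
assert (Hx : x < ln r).
{ apply ln_increasing; [lra|]. assert (m <= r) by apply Rmin_r. lra. }
assert (HJ : Cmod (CInt (fun v => F (x, v)) 0 (2 * PI) - scal (2 * PI - 0) (g 0))
             <= eps * (2 * PI - 0)).
{ apply CInt_bound with (fun v => F (x, v) - g 0)%C; [lra| |].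
  - apply (is_RInt_minus (V := C_R_NormedModule)).
    + apply (RInt_correct (V := C_R_CompleteNormedModule)), EX; lra.
    + apply (is_RInt_const (V := C_R_NormedModule)).
  - intros t _. unfold F, cexp; simpl. unfold x. rewrite exp_ln by lra.
    specialize (K (m / 2 * cos t, m / 2 * sin t)). cbv beta in K.
    assert (Hp := Cmod_polar (m / 2) t ltac:(lra)).
    set (p := (m / 2 * cos t, m / 2 * sin t) : C) in *.
    replace (p - 0)%C with p in K by ring. rewrite Hp in K.
    assert (M1 : m <= d) by (eapply Rle_trans; apply Rmin_l).
    assert (M2 : m <= eps / (Cmod l + 1)).
    { eapply Rle_trans; [apply Rmin_l|apply Rmin_r]. }
    eapply Rle_trans; [apply K; lra|].
    apply Rle_trans with ((Cmod l + 1) * (eps / (Cmod l + 1))).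
    + apply Rmult_le_compat_l; lra.
    + right; field; lra. }
rewrite EqI in HJ by easy.
set (I := CInt (fun v => F (ln r, v)) 0 (2 * PI)) in *.
rewrite scal_R_Cmult in HJ.
assert (T : Cmod (RtoC (2 * PI - 0) * g 0) <= Cmod I + Cmod (I - RtoC (2 * PI - 0) * g 0)).
{ rewrite <- (Cmod_opp (I - _)).
  replace (RtoC (2 * PI - 0) * g 0)%C with (I + - (I - RtoC (2 * PI - 0) * g 0))%C at 1 by ring.
  apply Cmod_triangle. }
rewrite Cmod_mult, Cmod_R, Rabs_pos_eq in T by lra.
apply Rmult_le_reg_l with (2 * PI - 0); [lra|]. lra.
Qed.

(** * Automorphisms of the disc and the identity theorem *)

Definition moebius (a w : C) : C := ((w + a) / (1 + Cconj a * w))%C.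

Lemma moebius_modulus (a w : C) :
  Cmod (1 + Cconj a * w) ^ 2 - Cmod (w + a) ^ 2 = (1 - Cmod a ^ 2) * (1 - Cmod w ^ 2).
Proof.
rewrite !Cmod2_alt. destruct a as [a b], w as [x y]; unfold Re, Im; simpl. ring.
Qed.

Lemma moebius_denominator (a w : C) : Cmod a < 1 -> Cmod w < 1 ->
  1 - Cmod a <= Cmod (1 + Cconj a * w).
Proof.
intros Ha Hw.
assert (T : 1 <= Cmod (1 + Cconj a * w) + Cmod (Cconj a * w)).
{ rewrite <- Cmod_1 at 1.
  replace (RtoC 1) with ((1 + Cconj a * w) + - (Cconj a * w))%C at 1 by ring.
  eapply Rle_trans; [apply Cmod_triangle|]. rewrite Cmod_opp; lra. }
rewrite Cmod_mult, Cmod_conj in T.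
assert (P := Cmod_ge_0 a). assert (P' := Cmod_ge_0 w). nra.
Qed.

Lemma moebius_nonzero (a w : C) : Cmod a < 1 -> Cmod w < 1 -> (1 + Cconj a * w)%C <> 0.
Proof.
intros Ha Hw. apply Cmod_gt_0. assert (H := moebius_denominator a w Ha Hw). lra.
Qed.

Lemma Cmod_moebius (a w : C) : Cmod a < 1 -> Cmod w < 1 ->
  1 - Cmod (moebius a w) ^ 2
  = (1 - Cmod a ^ 2) * (1 - Cmod w ^ 2) / Cmod (1 + Cconj a * w) ^ 2.
Proof.
intros Ha Hw.
assert (H := moebius_denominator a w Ha Hw).
unfold moebius. rewrite Cmod_div by now apply moebius_nonzero.
rewrite <- moebius_modulus. field. lra.
Qed.

Lemma moebius_lt_1 (a w : C) : Cmod a < 1 -> Cmod w < 1 -> Cmod (moebius a w) < 1.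
Proof.
intros Ha Hw.
assert (H := moebius_denominator a w Ha Hw).
assert (E := Cmod_moebius a w Ha Hw).
assert (Pa := Cmod_ge_0 a). assert (Pw := Cmod_ge_0 w).
assert (0 < 1 - Cmod (moebius a w) ^ 2).
{ rewrite E. apply Rdiv_lt_0_compat; [apply Rmult_lt_0_compat; nra|apply pow_lt; lra]. }
assert (Pm := Cmod_ge_0 (moebius a w)). nra.
Qed.

Lemma cderiv_moebius (a w : C) : Cmod a < 1 -> Cmod w < 1 ->
  exists l, cderiv (moebius a) w l.
Proof.
intros Ha Hw. eexists. apply (cderiv_div (fun w => w + a)%C (fun w => 1 + Cconj a * w)%C).
- now apply moebius_nonzero.
- apply deriv_along_plus; [apply deriv_along_id|apply deriv_along_const].
- apply deriv_along_plus; [apply deriv_along_const|apply deriv_along_scal, deriv_along_id].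
Qed.

(** Dividing by z^m takes the place of a Taylor expansion. As [moebius a] sends 0 to a, the mean
    value bound on the circle |w| = r becomes a bound at a by values on a closed curve; for suitable
    r < 1 this curve lies in |z| >= q with q > |a|. The powers (|a|/q)^m then tend to 0 while h
    stays bounded on the curve. *)
Theorem disc_identity (h : C -> C) (delta : R) : 0 < delta ->
  (forall z, Cmod z < 1 -> exists l, cderiv h z l) ->
  (forall z, Cmod z < delta -> h z = 0) ->
  forall z, Cmod z < 1 -> h z = 0.
Proof.
intros Hdelta Hh H0 a Ha.
destruct (Rlt_le_dec (Cmod a) delta) as [Hlt|Hge]; [now apply H0|].
set (c := Cmod a) in *.
assert (Hc : 0 < c) by lra.
assert (Ha0 : a <> 0) by now apply Cmod_gt_0.
(* With 1 - r^2 = (1-c)^2/2 and |1 + Cconj a w| >= 1 - c, [Cmod_moebius] gives 1 - |moebius a w|^2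
   <= (1-c^2)/2 on |w| = r, that is |moebius a w| >= q > c. *)
set (r := sqrt (1 - (1 - c) ^ 2 / 2)).
assert (Hr2 : r ^ 2 = 1 - (1 - c) ^ 2 / 2) by (apply pow2_sqrt; nra).
assert (Hr0 : 0 < r) by (apply sqrt_lt_R0; nra).
assert (Hr1 : r < 1) by nra.
set (q := sqrt ((1 + c ^ 2) / 2)).
assert (Hq2 : q ^ 2 = (1 + c ^ 2) / 2) by (apply pow2_sqrt; nra).
assert (Hq0 : 0 < q) by (apply sqrt_lt_R0; nra).
assert (Hcq : c < q) by nra.
assert (Hphi : forall w, Cmod w = r -> q <= Cmod (moebius a w)).
{ intros w Hw.
  assert (E := Cmod_moebius a w Ha ltac:(lra)).
  assert (D := moebius_denominator a w Ha ltac:(lra)). fold c in E, D.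
  rewrite Hw, Hr2 in E.
  assert (D2 : (1 - c) ^ 2 <= Cmod (1 + Cconj a * w) ^ 2) by (apply pow_incr; lra).
  assert (L : (1 - c ^ 2) * (1 - (1 - (1 - c) ^ 2 / 2)) / Cmod (1 + Cconj a * w) ^ 2
              <= (1 - c ^ 2) / 2).
  { apply Rle_div_l; [apply pow_lt; lra|].
    replace ((1 - c ^ 2) * (1 - (1 - (1 - c) ^ 2 / 2)))
      with ((1 - c ^ 2) / 2 * (1 - c) ^ 2) by field.
    apply Rmult_le_compat_l; [nra|easy]. }
  rewrite <- E in L.
  apply Rsqr_incr_0; [rewrite !Rsqr_pow2, Hq2; lra|lra|apply Cmod_ge_0]. }
assert (Hcurve : forall y, exists l, rderiv (fun y => h (moebius a (r * cos y, r * sin y))) y l).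
{ intros y.
  assert (Hw : Cmod (r * cos y, r * sin y) < 1) by (rewrite Cmod_polar; lra).
  destruct (cderiv_moebius a _ Ha Hw) as [l1 H1].
  destruct (Hh _ (moebius_lt_1 a _ Ha Hw)) as [l2 H2].
  eexists. apply (deriv_along_comp _ h (fun y => moebius a (r * cos y, r * sin y))); [exact H2|].
  apply (deriv_along_comp _ (moebius a) (fun y => (r * cos y, r * sin y))); [exact H1|].
  apply (rderiv_pair (fun y => r * cos y) (fun y => r * sin y)); auto_derive; try easy; reflexivity. }
destruct (bounded_continuity (V := C_R_NormedModule)
  (fun y => h (moebius a (r * cos y, r * sin y))) 0 (2 * PI)) as [B HB].
{ intros y _. destruct (Hcurve y) as [l Hl]. exact (rderiv_continuous _ _ _ Hl). }
assert (HB' : forall y, 0 <= y <= 2 * PI -> Cmod (h (moebius a (r * cos y, r * sin y))) <= B).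
{ intros y Hy. left. rewrite Cmod_norm. now apply HB. }
assert (HBpos : 0 <= B).
{ eapply Rle_trans; [apply Cmod_ge_0|apply (HB' 0)]. assert (P := PI_RGT_0). lra. }
(* h vanishes near 0, so h(w)/w^m is still holomorphic there; the mean value
   bound for it gives |h a| / c^m <= B / q^m with c < q. *)
assert (Hm : forall m, Cmod (h a) <= B * (c / q) ^ m).
{ intros m.
  (* For m > 0 the inverse takes a default value at z = 0, where it is multiplied by h 0 = 0. *)
  set (g := fun z => (h z * / z ^ m)%C).
  assert (Hg : forall z, Cmod z < 1 -> exists l, cderiv g z l).
  { intros z Hz. destruct (Rlt_le_dec (Cmod z) delta) as [L|L].
    - exists 0. apply (deriv_along_ext_loc _ (fun _ => RtoC 0) g z _ (delta - Cmod z)); [lra| |apply deriv_along_const].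
      intros y Hy. unfold g. rewrite H0; [ring|].
      replace y with (z + (y - z))%C by ring.
      eapply Rle_lt_trans; [apply Cmod_triangle|]. lra.
    - assert (Hz0 : z <> 0) by (apply Cmod_gt_0; lra).
      assert (Hp : exists l, cderiv (fun y => / y ^ m)%C z l).
      { destruct m as [|m]; [exists 0; exact (deriv_along_const _ (/ 1)%C z)|].
        eexists. apply (deriv_along_comp _ Cinv (fun y => y ^ S m)%C);
          [apply cderiv_inv, Cpow_nz, Hz0|].
        apply deriv_along_pow, deriv_along_id. }
      destruct (Hh z Hz) as [l Hl]. destruct Hp as [l' Hl']. eexists.
      apply deriv_along_mult; [exact Hl|exact Hl']. }
  assert (K : Cmod (g (moebius a 0)) <= B * / q ^ m).
  { apply (mean_value_bound (fun w => g (moebius a w)) r); [lra| |].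
    - intros w Hw. destruct (cderiv_moebius a w Ha Hw) as [l1 H1].
      destruct (Hg _ (moebius_lt_1 a w Ha Hw)) as [l2 H2].
      exists (l2 * l1)%C. apply (deriv_along_comp _ g (moebius a)); [exact H2|exact H1].
    - intros y Hy. unfold g.
      assert (Q := Hphi (r * cos y, r * sin y) ltac:(apply Cmod_polar; lra)).
      rewrite Cmod_mult, Cmod_inv, Cmod_pow.
      2:{ apply Cpow_nz, Cmod_gt_0. lra. }
      apply Rmult_le_compat; [apply Cmod_ge_0| |now apply HB'|].
      + left; apply Rinv_0_lt_compat, pow_lt; lra.
      + apply Rinv_le_contravar; [apply pow_lt; lra|apply pow_incr; lra]. }
  replace (moebius a 0) with a in K.
  2:{ unfold moebius. field. }
  unfold g in K. rewrite Cmod_mult, Cmod_inv, Cmod_pow in K by now apply Cpow_nz.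
  fold c in K.
  assert (Pc : 0 < c ^ m) by now apply pow_lt.
  assert (Pq : 0 < q ^ m) by now apply pow_lt.
  unfold Rdiv. rewrite Rpow_mult_distr, pow_inv.
  apply (Rmult_le_compat_r (c ^ m)) in K; [|lra].
  replace (Cmod (h a) * / c ^ m * c ^ m) with (Cmod (h a)) in K by (field; lra).
  lra. }
apply Cmod_eq_0, Rle_antisym; [|apply Cmod_ge_0].
apply Rnot_lt_le; intros Hpos.
assert (Hcq1 : Rabs (c / q) < 1).
{ rewrite Rabs_pos_eq by (apply Rlt_le, Rdiv_lt_0_compat; lra).
  apply Rlt_div_l; lra. }
destruct (pow_lt_1_zero _ Hcq1 (Cmod (h a) / (B + 1))) as [N HN].
{ apply Rdiv_lt_0_compat; lra. }
specialize (HN N (Nat.le_refl _)). specialize (Hm N).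
assert (HN' := Rle_lt_trans _ _ _ (Rle_abs _) HN).
assert (B * (c / q) ^ N <= (B + 1) * (c / q) ^ N).
{ apply Rmult_le_compat_r; [|lra]. apply pow_le. apply Rlt_le, Rdiv_lt_0_compat; lra. }
apply (Rmult_lt_compat_l (B + 1)) in HN'; [|lra].
replace ((B + 1) * (Cmod (h a) / (B + 1))) with (Cmod (h a)) in HN' by (field; lra).
lra.
Qed.

(** * Complex power series with real coefficients *)

Notation is_Cseries := (is_series (K := C_AbsRing) (V := C_NormedModule)).

Lemma is_Cseries_fst (u : nat -> C) (l : C) :
  is_Cseries u l -> is_series (fun n => fst (u n)) (fst l).
Proof.
intros H P [e He].
assert (Q := H (fun z => P (fst z)) (ex_intro _ e (fun z Hz => He (fst z) (proj1 Hz)))).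
destruct Q as [N HN]. exists N. intros n Hn. specialize (HN n Hn).
assert (E : fst (sum_n (G := C_AbelianMonoid) u n) = sum_n (fun k => fst (u k)) n).
2:{ exact (eq_ind _ P HN _ E). }
clear. induction n as [|n IH]; [now rewrite !sum_O|]. rewrite !sum_Sn, <- IH. reflexivity.
Qed.

Lemma is_Cseries_snd (u : nat -> C) (l : C) :
  is_Cseries u l -> is_series (fun n => snd (u n)) (snd l).
Proof.
intros H P [e He].
assert (Q := H (fun z => P (snd z)) (ex_intro _ e (fun z Hz => He (snd z) (proj2 Hz)))).
destruct Q as [N HN]. exists N. intros n Hn. specialize (HN n Hn).
assert (E : snd (sum_n (G := C_AbelianMonoid) u n) = sum_n (fun k => snd (u k)) n).
2:{ exact (eq_ind _ P HN _ E). }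
clear. induction n as [|n IH]; [now rewrite !sum_O|]. rewrite !sum_Sn, <- IH. reflexivity.
Qed.

Lemma is_Cseries_bound (u : nat -> C) (l : C) (b : nat -> R) (B : R) :
  is_Cseries u l -> is_series b B -> (forall n, Cmod (u n) <= b n) -> Cmod l <= B.
Proof.
intros Hu Hb Hle. apply le_epsilon. intros eps He.
assert (Hsum : forall n, Cmod (sum_n (G := C_AbelianMonoid) u n) <= sum_n b n).
{ intros n; induction n as [|n IH]; [rewrite !sum_O; apply Hle|].
  rewrite !sum_Sn. eapply Rle_trans; [apply Cmod_triangle|].
  now apply Rplus_le_compat. }
assert (He2 : 0 < eps / 2) by lra.
(* The balls of [C_UniformSpace] are squares; the one of radius eps/2 lies in the disc of radius eps
   because sqrt 2 <= 2. *)
assert (Q : locally (T := C_UniformSpace) l (fun z => Cmod (z - l) < eps)).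
{ exists (mkposreal _ He2). intros z Hz.
  eapply Rlt_le_trans; [apply (C_NormedModule_mixin_compat2 l z (mkposreal _ He2) Hz)|].
  simpl. assert (S2 : sqrt 2 <= 2); [|nra].
  rewrite <- (sqrt_square 2) at 2 by lra. apply sqrt_le_1; lra. }
destruct (Hu _ Q) as [N HN].
specialize (HN N (Nat.le_refl N)). cbv beta in HN. specialize (Hsum N).
assert (Hmono : sum_n b N <= B).
{ rewrite sum_n_Reals. apply sum_incr.
  - apply is_series_Reals in Hb. exact Hb.
  - intros n. eapply Rle_trans; [apply Cmod_ge_0|apply Hle]. }
replace l with (sum_n (G := C_AbelianMonoid) u N - (sum_n (G := C_AbelianMonoid) u N - l))%C by ring.
eapply Rle_trans; [apply Cmod_triangle|]. rewrite Cmod_opp.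
apply Rplus_le_compat; [lra|]. left; exact HN.
Qed.

(** A total function: real and imaginary parts are sums of real series, with a default value where
    they diverge. [Cpser_correct] makes it the genuine sum on the disc. *)
Definition Cpser (a : nat -> R) (z : C) : C :=
  (Series (fun m => fst (RtoC (a m) * z ^ m)%C), Series (fun m => snd (RtoC (a m) * z ^ m)%C)).

Lemma Cpser_unique (a : nat -> R) (z l : C) :
  is_Cseries (fun m => RtoC (a m) * z ^ m)%C l -> Cpser a z = l.
Proof.
intros H. unfold Cpser.
rewrite (is_series_unique _ _ (is_Cseries_fst _ _ H)).
rewrite (is_series_unique _ _ (is_Cseries_snd _ _ H)).
symmetry; apply surjective_pairing.
Qed.

Definition disc_conv (a : nat -> R) : Prop := Rbar_le 1 (CV_radius a).

Lemma disc_conv_intro (a : nat -> R) :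
  (forall r, 0 < r < 1 -> exists M, forall n, Rabs (a n) * r ^ n <= M) -> disc_conv a.
Proof.
intros H. unfold disc_conv.
destruct (Rbar_le_lt_dec 1 (CV_radius a)) as [L|L]; [exact L|exfalso].
assert (P := CV_radius_ge_0 a).
assert (B := CV_radius_bounded a).
destruct (CV_radius a) as [c| |]; simpl in *; try easy.
destruct B as [B _].
(* The midpoint between a radius c < 1 and 1: boundedness there would force (c+1)/2 <= c. *)
assert (Hr : 0 < (c + 1) / 2 < 1) by lra.
destruct (H _ Hr) as [M HM].
specialize (B ((c + 1) / 2)). simpl in B.
assert (K : (c + 1) / 2 <= c); [apply B|lra].
exists M. intros n. rewrite Rabs_mult, (Rabs_pos_eq (_ ^ n)); [apply HM|].
apply pow_le; lra.
Qed.

Lemma disc_conv_ex_series (a : nat -> R) (r : R) : disc_conv a -> 0 <= r < 1 ->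
  ex_series (fun n => Rabs (a n) * r ^ n).
Proof.
intros H Hr. apply ex_series_ext with (fun n => Rabs (a n * r ^ n)).
- intros n. rewrite Rabs_mult, (Rabs_pos_eq (_ ^ n)); [easy|]. apply pow_le; lra.
- apply CV_disk_inside. rewrite Rabs_pos_eq by lra.
  eapply Rbar_lt_le_trans; [|exact H]. simpl; lra.
Qed.

Lemma disc_conv_bound (a : nat -> R) (r : R) : disc_conv a -> 0 <= r < 1 ->
  exists M, forall n, Rabs (a n) * r ^ n <= M.
Proof.
intros H Hr. assert (E := disc_conv_ex_series a r H Hr).
exists (Series (fun n => Rabs (a n) * r ^ n)). intros n.
assert (P : forall k, 0 <= Rabs (a k) * r ^ k).
{ intros k. apply Rmult_le_pos; [apply Rabs_pos|apply pow_le; lra]. }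
destruct E as [S HS]. rewrite (is_series_unique _ _ HS).
apply Rle_trans with (sum_n (fun n => Rabs (a n) * r ^ n) n).
- destruct n; [rewrite sum_O; lra|]. rewrite sum_Sn. unfold plus; simpl.
  rewrite <- (Rplus_0_l (Rabs _ * _)) at 1. apply Rplus_le_compat_r.
  rewrite sum_n_Reals. apply cond_pos_sum. exact P.
- rewrite sum_n_Reals. apply sum_incr; [|exact P].
  apply is_series_Reals in HS. exact HS.
Qed.

Lemma Cpser_correct (a : nat -> R) (z : C) : disc_conv a -> Cmod z < 1 ->
  is_Cseries (fun m => RtoC (a m) * z ^ m)%C (Cpser a z).
Proof.
intros Ha Hz.
assert (E : ex_series (K := C_AbsRing) (V := C_NormedModule) (fun m => RtoC (a m) * z ^ m)%C).
{ apply (ex_series_le (K := C_AbsRing) (V := C_CompleteNormedModule)) with (fun n => Rabs (a n) * Cmod z ^ n).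
  - intros n. change (Cmod (RtoC (a n) * z ^ n) <= Rabs (a n) * Cmod z ^ n).
    rewrite Cmod_mult, Cmod_pow, Cmod_R; lra.
  - apply disc_conv_ex_series; [easy|]. split; [apply Cmod_ge_0|easy]. }
destruct E as [l Hl]. rewrite (Cpser_unique _ _ _ Hl). exact Hl.
Qed.

Lemma Cpser_ext (a b : nat -> R) z : (forall n, a n = b n) -> Cpser a z = Cpser b z.
Proof. intros E. unfold Cpser. f_equal; apply Series_ext; intros n; now rewrite E. Qed.

Lemma disc_conv_shift (a : nat -> R) : disc_conv a -> disc_conv (fun n => a (S n)).
Proof. intros H. change (Rbar_le 1 (CV_radius (PS_decr_1 (K := R_AbsRing) (V := R_NormedModule) a))).
now rewrite CV_radius_decr_1.
Qed.

Lemma disc_conv_derive (a : nat -> R) : disc_conv a -> disc_conv (PS_derive a).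
Proof. intros H. unfold disc_conv. now rewrite CV_radius_derive. Qed.

Lemma disc_conv_Int (a : nat -> R) : disc_conv a -> disc_conv (PS_Int a).
Proof. intros H. unfold disc_conv. now rewrite CV_radius_Int. Qed.

Lemma disc_conv_lin (a b : nat -> R) (p q : R) : disc_conv a -> disc_conv b ->
  disc_conv (fun n => p * a n + q * b n).
Proof.
intros Ha Hb. apply disc_conv_intro. intros r Hr.
destruct (disc_conv_bound a r Ha) as [M HM]; [lra|].
destruct (disc_conv_bound b r Hb) as [N HN]; [lra|].
exists (Rabs p * M + Rabs q * N). intros n. specialize (HM n). specialize (HN n).
assert (T := Rabs_triang (p * a n) (q * b n)). rewrite !Rabs_mult in T.
assert (P : 0 < r ^ n) by (apply pow_lt; lra).
apply Rle_trans with ((Rabs p * Rabs (a n) + Rabs q * Rabs (b n)) * r ^ n).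
- apply Rmult_le_compat_r; lra.
- assert (P1 := Rmult_le_compat_l _ _ _ (Rabs_pos p) HM).
  assert (P2 := Rmult_le_compat_l _ _ _ (Rabs_pos q) HN). lra.
Qed.

Lemma Cpser_lin (a b : nat -> R) (p q : R) z : disc_conv a -> disc_conv b -> Cmod z < 1 ->
  Cpser (fun n => p * a n + q * b n) z = (RtoC p * Cpser a z + RtoC q * Cpser b z)%C.
Proof.
intros Ha Hb Hz. apply Cpser_unique.
apply is_series_ext with (fun n => plus (scal (RtoC p) (RtoC (a n) * z ^ n)%C : C_NormedModule)
                                        (scal (RtoC q) (RtoC (b n) * z ^ n)%C : C_NormedModule)).
- intros n. change (RtoC p * (RtoC (a n) * z ^ n) + RtoC q * (RtoC (b n) * z ^ n)
                    = RtoC (p * a n + q * b n) * z ^ n)%C.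
  rewrite RtoC_plus, !RtoC_mult. ring.
- apply (is_series_plus (K := C_AbsRing) (V := C_NormedModule));
  apply (is_series_scal (K := C_AbsRing) (V := C_NormedModule)); now apply Cpser_correct.
Qed.

Lemma Cpser_shift (a : nat -> R) z : disc_conv a -> Cmod z < 1 ->
  Cpser a z = (RtoC (a O) + z * Cpser (fun n => a (S n)) z)%C.
Proof.
intros Ha Hz. apply Cpser_unique.
apply (is_series_decr_1 (K := C_AbsRing) (V := C_NormedModule)).
replace (plus _ _) with (z * Cpser (fun n => a (S n)) z)%C.
2:{ change (z * Cpser (fun n => a (S n)) z
      = (RtoC (a O) + z * Cpser (fun n => a (S n)) z) + - (RtoC (a O) * z ^ 0))%C. simpl. ring. }
apply is_series_ext with (fun n => (scal z (RtoC (a (S n)) * z ^ n)%C : C_NormedModule)).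
- intros n. change (z * (RtoC (a (S n)) * z ^ n) = RtoC (a (S n)) * (z * z ^ n))%C. ring.
- apply (is_series_scal (K := C_AbsRing) (V := C_NormedModule)). apply Cpser_correct; [|easy].
  now apply disc_conv_shift.
Qed.

Lemma Cpser_0 (a : nat -> R) : disc_conv a -> Cpser a 0 = RtoC (a O).
Proof. intros Ha. rewrite Cpser_shift; [ring|easy|rewrite Cmod_0; lra]. Qed.

(* Coefficients of the quotient of a power series by 1 - c z. *)
Fixpoint geom (c : R) (a : nat -> R) (n : nat) : R :=
  match n with O => a O | S m => a (S m) + c * geom c a m end.

(** If |a n| r^n <= M for all n, the recursion for |geom c a n| r^n is dominated by B = M + r B,
    whose solution is M/(1-r). *)
Lemma disc_conv_geom (c : R) (a : nat -> R) : Rabs c <= 1 -> disc_conv a -> disc_conv (geom c a).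
Proof.
intros Hc Ha. apply disc_conv_intro. intros r Hr.
destruct (disc_conv_bound a r Ha) as [M HM]; [lra|].
exists (M / (1 - r)). assert (M0 := HM O). simpl in M0.
assert (A0 := Rabs_pos (a O)).
assert (E : M / (1 - r) = M + r * (M / (1 - r))) by (field; lra).
assert (P : 0 <= M / (1 - r)) by (apply Rdiv_le_0_compat; lra).
induction n as [|n IH].
- simpl. rewrite E. assert (0 <= r * (M / (1 - r))) by (apply Rmult_le_pos; lra). lra.
- simpl geom. rewrite E.
  assert (T := Rabs_triang (a (S n)) (c * geom c a n)). rewrite Rabs_mult in T.
  assert (Pn : 0 < r ^ S n) by (apply pow_lt; lra).
  apply Rle_trans with (Rabs (a (S n)) * r ^ S n + Rabs c * Rabs (geom c a n) * r ^ S n).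
  { rewrite <- Rmult_plus_distr_r. apply Rmult_le_compat_r; lra. }
  apply Rplus_le_compat; [apply HM|]. simpl pow.
  apply Rle_trans with (r * (Rabs (geom c a n) * r ^ n)); [|apply Rmult_le_compat_l; lra].
  replace (Rabs c * Rabs (geom c a n) * (r * r ^ n))
    with (Rabs c * (r * (Rabs (geom c a n) * r ^ n))) by ring.
  rewrite <- (Rmult_1_l (r * _)) at 2. apply Rmult_le_compat_r; [|easy].
  apply Rmult_le_pos; [lra|]. apply Rmult_le_pos; [apply Rabs_pos|apply pow_le; lra].
Qed.

Lemma Cpser_geom (c : R) (a : nat -> R) z : Rabs c <= 1 -> disc_conv a -> Cmod z < 1 ->
  ((1 - RtoC c * z) * Cpser (geom c a) z = Cpser a z)%C.
Proof.
intros Hc Ha Hz.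
assert (Hg := disc_conv_geom c a Hc Ha).
rewrite (Cpser_shift a) by easy.
rewrite (Cpser_ext (fun n => a (S n)) (fun n => 1 * geom c a (S n) + (- c) * geom c a n)).
2:{ intros n; simpl; ring. }
rewrite Cpser_lin; [|now apply (disc_conv_shift (geom c a))|easy|easy].
replace (RtoC (a O)) with (Cpser (geom c a) z - z * Cpser (fun n => geom c a (S n)) z)%C.
- rewrite RtoC_opp. ring.
- rewrite (Cpser_shift (geom c a)) by easy. simpl. ring.
Qed.

(** Induction on n, multiplying the remainder by w. The constant (n+1)(n+2) is chosen so that,
    multiplied by a (n+2), it gives the coefficient of [PS_derive (PS_derive a)]. *)
Lemma Cpow_taylor (s : R) (z w : C) (n : nat) : 0 <= s -> Cmod z <= s -> Cmod w <= s ->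
  Cmod (w ^ S (S n) - z ^ S (S n) - RtoC (INR (S (S n))) * z ^ S n * (w - z))
  <= INR (S n) * INR (S (S n)) * s ^ n * Cmod (w - z) ^ 2.
Proof.
intros Hs Hz Hw.
assert (Hh := Cmod_ge_0 (w - z)).
induction n as [|n IH].
- simpl. replace (w * (w * 1) - z * (z * 1) - RtoC (1 + 1) * (z * 1) * (w - z))%C
    with ((w - z) * (w - z))%C by (rewrite RtoC_plus; ring).
  rewrite Cmod_mult. nra.
- replace (w ^ S (S (S n)) - z ^ S (S (S n)) - RtoC (INR (S (S (S n)))) * z ^ S (S n) * (w - z))%C
    with (w * (w ^ S (S n) - z ^ S (S n) - RtoC (INR (S (S n))) * z ^ S n * (w - z))
          + RtoC (INR (S (S n))) * z ^ S n * ((w - z) * (w - z)))%C.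
  2:{ rewrite (S_INR (S (S n))), RtoC_plus. simpl Cpow. ring. }
  eapply Rle_trans; [apply Cmod_triangle|].
  rewrite !Cmod_mult, Cmod_pow, Cmod_R, (Rabs_pos_eq (INR _)) by apply pos_INR.
  assert (Pz : Cmod z ^ S n <= s ^ S n) by (apply pow_incr; split; [apply Cmod_ge_0|easy]).
  assert (Ps : 0 <= s ^ S n) by now apply pow_le.
  assert (Ps' : 0 <= s ^ n) by now apply pow_le.
  set (e := Cmod (w - z)) in *.
  match goal with |- Cmod w * ?X + _ <= _ => set (T := X) in * end.
  assert (PT : 0 <= T) by apply Cmod_ge_0.
  assert (B1 : Cmod w * T <= s * (INR (S n) * INR (S (S n)) * s ^ n * e ^ 2)).
  { apply Rmult_le_compat; try easy. apply Cmod_ge_0. }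
  assert (PI : 0 <= INR (S (S n))) by apply pos_INR.
  assert (B2 : INR (S (S n)) * Cmod z ^ S n * (e * e) <= INR (S (S n)) * s ^ S n * (e * e)).
  { apply Rmult_le_compat_r; [nra|]. now apply Rmult_le_compat_l. }
  rewrite (S_INR (S (S n))), (S_INR (S n)) in *. simpl pow in *.
  assert (PI' : 0 <= INR (S n)) by apply pos_INR.
  assert (X : 0 <= (INR (S n) + 1) * (s * s ^ n) * (e * e)).
  { repeat apply Rmult_le_pos; try easy. }
  nra.
Qed.

(** The second-order remainders are summed term by term: the total error is at most K |w-z|^2, where
    K is the sum of absolute values of the twice derived series at a radius s strictly between |z|
    and 1. *)
Theorem cderiv_Cpser (a : nat -> R) (z : C) : disc_conv a -> Cmod z < 1 ->
  cderiv (Cpser a) z (Cpser (PS_derive a) z).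
Proof.
intros Ha Hz.
set (s := (1 + Cmod z) / 2). assert (Pz := Cmod_ge_0 z).
assert (Hs : Cmod z < s < 1) by (unfold s; lra).
assert (H2 : disc_conv (PS_derive (PS_derive a))) by now apply disc_conv_derive, disc_conv_derive.
destruct (disc_conv_ex_series _ s H2) as [K HK]; [lra|].
assert (HK0 : 0 <= K).
{ assert (P : forall n, 0 <= Rabs (PS_derive (PS_derive a) n) * s ^ n).
  { intros n. apply Rmult_le_pos; [apply Rabs_pos|apply pow_le; lra]. }
  eapply Rle_trans; [apply (P O)|].
  apply is_series_Reals in HK. exact (sum_incr _ O K HK P). }
intros eps He.
assert (Hd : 0 < eps / (K + 1)) by (apply Rdiv_lt_0_compat; lra).
exists (Rmin (s - Cmod z) (eps / (K + 1))); split; [apply Rmin_pos; lra|].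
intros w Hw.
assert (Hw1 := Rlt_le_trans _ _ _ Hw (Rmin_l _ _)).
assert (Hw2 := Rlt_le_trans _ _ _ Hw (Rmin_r _ _)).
assert (Hws : Cmod w < s).
{ replace w with (z + (w - z))%C by ring.
  eapply Rle_lt_trans; [apply Cmod_triangle|]. lra. }
assert (Hh := Cmod_ge_0 (w - z)).
apply Rle_trans with (K * Cmod (w - z) ^ 2).
2:{ replace (K * Cmod (w - z) ^ 2) with (K * Cmod (w - z) * Cmod (w - z)) by ring.
    apply Rmult_le_compat_r; [easy|].
    apply Rle_trans with ((K + 1) * (eps / (K + 1))).
    - apply Rmult_le_compat; lra.
    - right; field; lra. }
assert (Hw01 : Cmod w < 1) by lra.
set (b := fun n => a (S (S n))).
assert (Hb : disc_conv b) by (apply (disc_conv_shift (fun n => a (S n))); now apply disc_conv_shift).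
assert (Hda := disc_conv_derive a Ha).
(* The terms of degree 0 and 1 leave no remainder; splitting them off matches the exponents S (S n)
   of [Cpow_taylor]. *)
rewrite (Cpser_shift a w), (Cpser_shift a z), (Cpser_shift (PS_derive a) z) by easy.
rewrite (Cpser_shift (fun n => a (S n)) w), (Cpser_shift (fun n => a (S n)) z)
  by (try apply disc_conv_shift; easy).
fold b. set (d := fun n => PS_derive a (S n)).
assert (Hd' : disc_conv d) by now apply (disc_conv_shift (PS_derive a)).
apply (is_Cseries_bound (fun n => RtoC (a (S (S n))) *
   (w ^ S (S n) - z ^ S (S n) - RtoC (INR (S (S n))) * z ^ S n * (w - z)))%C _
   (fun n => Cmod (w - z) ^ 2 * (Rabs (PS_derive (PS_derive a) n) * s ^ n))).
- apply is_series_ext with (fun n =>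
    plus (plus (scal (w * w)%C (RtoC (b n) * w ^ n)%C : C_NormedModule)
               (scal (- (z * z))%C (RtoC (b n) * z ^ n)%C : C_NormedModule))
         (scal (- (z * (w - z)))%C (RtoC (d n) * z ^ n)%C : C_NormedModule)).
  + intros n. unfold b, d, PS_derive. rewrite RtoC_mult.
    match goal with |- ?l = ?r => change (w * w * (RtoC (a (S (S n))) * w ^ n)
      + - (z * z) * (RtoC (a (S (S n))) * z ^ n)
      + - (z * (w - z)) * (RtoC (INR (S (S n))) * RtoC (a (S (S n))) * z ^ n) = r)%C end.
    simpl Cpow. ring.
  + replace (RtoC (a 0%nat) + w * (RtoC (a 1%nat) + w * Cpser b w)
       - (RtoC (a 0%nat) + z * (RtoC (a 1%nat) + z * Cpser b z))
       - (RtoC (PS_derive a 0) + z * Cpser d z) * (w - z))%C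
    with ((w * w) * Cpser b w + - (z * z) * Cpser b z + - (z * (w - z)) * Cpser d z)%C.
    2:{ replace (PS_derive a 0) with (a 1%nat) by (unfold PS_derive; simpl; ring). ring. }
    apply (is_series_plus (K := C_AbsRing) (V := C_NormedModule));
      [apply (is_series_plus (K := C_AbsRing) (V := C_NormedModule))|];
      apply (is_series_scal (K := C_AbsRing) (V := C_NormedModule)); now apply Cpser_correct.
- rewrite Rmult_comm. apply (is_series_scal (K := R_AbsRing) (V := R_NormedModule)
    (Cmod (w - z) ^ 2) _ K HK).
- intros n. rewrite Cmod_mult, Cmod_R.
  eapply Rle_trans.
  { apply Rmult_le_compat_l; [apply Rabs_pos|]. apply (Cpow_taylor s); lra. }
  unfold PS_derive. rewrite !Rabs_mult, !(Rabs_pos_eq (INR _)) by apply pos_INR.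
  right; ring.
Qed.

(** * The polylogarithms in the coordinates z and w *)

Lemma pow_n_Cpow (z : C) (n : nat) : pow_n (K := C_Ring) z n = (z ^ n)%C.
Proof. induction n as [|n IH]; [reflexivity|]. simpl. now rewrite <- IH. Qed.

Definition shift (a : nat -> R) (n : nat) : R := a (S n).

(* Integration against dz/(1-z) and dz/z. *)
Definition int1_z (a : nat -> R) : nat -> R := PS_Int (geom 1 a).
Definition int0_z (a : nat -> R) : nat -> R := PS_Int (shift a).

(* The same in the coordinate w of the unit disc, z = 4w/(1+w)^2:
   dz/(1-z) = (2/(1-w) + 2/(1+w)) dw and dz/z = (2/(1+w) - 1) dw/w. *)
Definition int1_w (a : nat -> R) : nat -> R :=
  PS_Int (fun n => 2 * geom 1 a n + 2 * geom (-1) a n).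
Definition int0_w (a : nat -> R) : nat -> R :=
  PS_Int (fun n => 2 * geom (-1) (shift a) n + (-1) * shift a n).

Definition unit_coef (n : nat) : R := if Nat.eqb n 0 then 1 else 0.

Section Words.
Variables (i1 i0 : (nat -> R) -> nat -> R).

(** One [i1] followed by p times [i0], that is, the form dz/(1-z) and then p = k_j - 1 copies of
    dz/z. Abstracting [i1] and [i0] lets the same words be read in z and in w. *)
Fixpoint block (a : nat -> R) (p : nat) : nat -> R :=
  match p with O => i1 a | S p' => i0 (block a p') end.

Fixpoint word_coef (k : nat -> nat) (j : nat) : nat -> R :=
  match j with
  | O => unit_coef
  | S j' => block (word_coef k j') (k (S j') - 1)
  end.
End Words.

Lemma disc_conv_unit : disc_conv unit_coef.
Proof.
apply disc_conv_intro. intros r Hr. exists 1. intros [|n]; unfold unit_coef; simpl.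
- rewrite Rabs_R1; lra.
- rewrite Rabs_R0; lra.
Qed.

Lemma Cpser_unit z : Cmod z < 1 -> Cpser unit_coef z = 1.
Proof.
intros Hz. rewrite Cpser_shift by (easy || apply disc_conv_unit).
(* The tail is the zero sequence, written with zero weights so that [Cpser_lin] evaluates it. *)
rewrite (Cpser_ext _ (fun n => 0 * unit_coef n + 0 * unit_coef n)) by (intros n; unfold unit_coef; simpl; ring).
rewrite Cpser_lin by (easy || apply disc_conv_unit).
unfold unit_coef at 1; simpl. ring.
Qed.

Lemma disc_conv_int1_z a : disc_conv a -> disc_conv (int1_z a).
Proof. intros H. apply disc_conv_Int, disc_conv_geom; [rewrite Rabs_R1; lra|easy]. Qed.

Lemma disc_conv_int0_z a : disc_conv a -> disc_conv (int0_z a).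
Proof. intros H. now apply disc_conv_Int, (disc_conv_shift a). Qed.

Lemma Rabs_m1 : Rabs (-1) <= 1.
Proof. rewrite Rabs_left; lra. Qed.

Lemma Rabs_p1 : Rabs 1 <= 1.
Proof. rewrite Rabs_R1; lra. Qed.

Lemma disc_conv_int1_w a : disc_conv a -> disc_conv (int1_w a).
Proof.
intros H. apply disc_conv_Int, disc_conv_lin; apply disc_conv_geom; try easy;
[apply Rabs_p1|apply Rabs_m1].
Qed.

Lemma disc_conv_int0_w a : disc_conv a -> disc_conv (int0_w a).
Proof.
intros H. assert (Hs := disc_conv_shift a H).
apply disc_conv_Int, disc_conv_lin; [|exact Hs]. apply disc_conv_geom; [apply Rabs_m1|exact Hs].
Qed.

Lemma cderiv_Cpser_Int a z : disc_conv a -> Cmod z < 1 ->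
  cderiv (Cpser (PS_Int a)) z (Cpser a z).
Proof.
intros Ha Hz.
rewrite (Cpser_ext a (PS_derive (PS_Int a))).
- apply cderiv_Cpser; [now apply disc_conv_Int|easy].
- intros n. unfold PS_derive, PS_Int. field. apply not_0_INR; lia.
Qed.

Lemma one_minus_neq (z : C) : Cmod z < 1 -> (1 - z)%C <> 0.
Proof.
intros Hz E. assert (K : z = 1) by (replace z with (1 - (1 - z))%C by ring; rewrite E; ring).
rewrite K, Cmod_1 in Hz. lra.
Qed.

Lemma one_plus_neq (z : C) : Cmod z < 1 -> (1 + z)%C <> 0.
Proof.
intros Hz E. apply (one_minus_neq (- z)); [now rewrite Cmod_opp|].
rewrite <- E. ring.
Qed.

Lemma Cpser_shift0 a z : disc_conv a -> a O = 0 -> Cmod z < 1 ->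
  Cpser a z = (z * Cpser (shift a) z)%C.
Proof. intros Ha H0 Hz. rewrite (Cpser_shift a), H0 by easy. unfold shift. ring. Qed.

Lemma cderiv_int1_z a z : disc_conv a -> Cmod z < 1 ->
  cderiv (Cpser (int1_z a)) z (Cpser a z / (1 - z))%C.
Proof.
intros Ha Hz.
rewrite <- (Cpser_geom 1 a z Rabs_p1 Ha Hz).
replace ((1 - 1 * z) * Cpser (geom 1 a) z / (1 - z))%C with (Cpser (geom 1 a) z).
- apply cderiv_Cpser_Int; [|easy]. apply disc_conv_geom; [apply Rabs_p1|easy].
- field. now apply one_minus_neq.
Qed.

Lemma cderiv_int0_z a z : disc_conv a -> a O = 0 -> Cmod z < 1 -> z <> 0 ->
  cderiv (Cpser (int0_z a)) z (Cpser a z / z)%C.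
Proof.
intros Ha H0 Hz Hz0.
rewrite (Cpser_shift0 a z) by easy.
replace (z * Cpser (shift a) z / z)%C with (Cpser (shift a) z) by (field; easy).
apply cderiv_Cpser_Int; [|easy]. now apply disc_conv_shift.
Qed.

Lemma cderiv_int1_w a w : disc_conv a -> Cmod w < 1 ->
  cderiv (Cpser (int1_w a)) w (4 * Cpser a w / ((1 - w) * (1 + w)))%C.
Proof.
intros Ha Hw.
assert (G1 := disc_conv_geom 1 a Rabs_p1 Ha).
assert (G2 := disc_conv_geom (-1) a Rabs_m1 Ha).
assert (N1 := one_minus_neq w Hw). assert (N2 := one_plus_neq w Hw).
replace (4 * Cpser a w / ((1 - w) * (1 + w)))%C
  with (Cpser (fun n => 2 * geom 1 a n + 2 * geom (-1) a n) w).
- apply cderiv_Cpser_Int; [|easy]. now apply disc_conv_lin.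
- rewrite Cpser_lin by easy.
  assert (E1 := Cpser_geom 1 a w Rabs_p1 Ha Hw).
  assert (E2 := Cpser_geom (-1) a w Rabs_m1 Ha Hw).
  replace (Cpser (geom 1 a) w) with (Cpser a w / (1 - w))%C by (rewrite <- E1; field; easy).
  replace (Cpser (geom (-1) a) w) with (Cpser a w / (1 + w))%C.
  2:{ rewrite <- E2. replace (RtoC (-1)) with (- (1))%C by (unfold Copp, RtoC; simpl; f_equal; ring). field; easy. }
  field. now split.
Qed.

Lemma cderiv_int0_w a w : disc_conv a -> a O = 0 -> Cmod w < 1 -> w <> 0 ->
  cderiv (Cpser (int0_w a)) w ((1 - w) * Cpser a w / (w * (1 + w)))%C.
Proof.
intros Ha H0 Hw Hw0.
assert (Hs := disc_conv_shift a Ha). fold (shift a) in Hs.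
assert (G2 := disc_conv_geom (-1) (shift a) Rabs_m1 Hs).
assert (N2 := one_plus_neq w Hw).
replace ((1 - w) * Cpser a w / (w * (1 + w)))%C
  with (Cpser (fun n => 2 * geom (-1) (shift a) n + (-1) * shift a n) w).
- apply cderiv_Cpser_Int; [|easy]. now apply disc_conv_lin.
- rewrite Cpser_lin by easy. rewrite (Cpser_shift0 a w) by easy.
  assert (E2 := Cpser_geom (-1) (shift a) w Rabs_m1 Hs Hw).
  assert (M1 : RtoC (-1) = (- (1))%C) by (unfold Copp, RtoC; simpl; f_equal; ring).
  rewrite M1 in *.
  replace (Cpser (geom (-1) (shift a)) w) with (Cpser (shift a) w / (1 + w))%C.
  2:{ rewrite <- E2. field; easy. }
  field. now split.
Qed.

Lemma block_O i0 i1 a p : (forall b, i1 b O = 0) -> (forall b, i0 b O = 0) ->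
  block i1 i0 a p O = 0.
Proof. intros H1 H0. destruct p; simpl; auto. Qed.

Lemma disc_conv_block i1 i0 a p : (forall b, disc_conv b -> disc_conv (i1 b)) ->
  (forall b, disc_conv b -> disc_conv (i0 b)) -> disc_conv a -> disc_conv (block i1 i0 a p).
Proof. intros H1 H0 Ha. induction p; simpl; auto. Qed.

Lemma disc_conv_word i1 i0 k j : (forall b, disc_conv b -> disc_conv (i1 b)) ->
  (forall b, disc_conv b -> disc_conv (i0 b)) -> disc_conv (word_coef i1 i0 k j).
Proof.
intros H1 H0. induction j; simpl; [apply disc_conv_unit|]. now apply disc_conv_block.
Qed.

(** Division by 1 - z turns coefficients into partial sums, and each of the p + 1 integrations
    divides the coefficient of degree m + 1 by m + 1. As [int0_z] shifts down before integrating, it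
    keeps the degree. *)
Lemma block_z_coef a p m : block int1_z int0_z a p (S m) = sum_f_R0 a m / INR (S m) ^ S p.
Proof.
assert (Hm : INR (S m) <> 0) by (apply not_0_INR; lia).
assert (Hg : forall m, geom 1 a m = sum_f_R0 a m).
{ clear. intros m; induction m as [|m IH]; [reflexivity|]. simpl. rewrite IH. ring. }
induction p as [|p IH].
- change (geom 1 a m / INR (S m) = sum_f_R0 a m / INR (S m) ^ 1). rewrite Hg. field. easy.
- change (block int1_z int0_z a p (S m) / INR (S m) = sum_f_R0 a m / (INR (S m) * INR (S m) ^ S p)).
  rewrite IH. assert (Hp := pow_nonzero _ (S p) Hm). set (u := INR (S m)) in *. set (v := u ^ S p) in *. field. now split.
Qed.

Lemma word_coef_z k j m : (forall u, (1 <= u <= j)%nat -> (1 <= k u)%nat) ->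
  word_coef int1_z int0_z k j m = mpl_coef k j m.
Proof.
revert m; induction j as [|j IH]; intros m Hk; [reflexivity|].
destruct m as [|m].
- now apply block_O.
- cbn [word_coef mpl_coef Nat.eqb]. rewrite block_z_coef.
  replace (S (k (S j) - 1)) with (k (S j)) by (specialize (Hk (S j)); lia).
  replace (S m - 1)%nat with m by lia. f_equal.
  apply sum_eq. intros l _. apply IH. intros u Hu. apply Hk; lia.
Qed.

(** The formulas for the derivatives of [int0_z] and [int0_w] divide by the variable, so they are
    used away from 0. There they make G constant on each open ray, and differentiability at 0 gives
    the limit G 0 = 0 along the ray. *)
Lemma zero_on_ball (G : C -> C) (delta : R) : G 0 = 0 ->
  (forall w, Cmod w < delta -> exists l, cderiv G w l) ->
  (forall w, Cmod w < delta -> w <> 0 -> cderiv G w 0) ->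
  forall w, Cmod w < delta -> G w = 0.
Proof.
intros G0 Hex Hder w Hw.
destruct (Ceq_dec w 0) as [->|Hw0]; [easy|].
assert (Hc : 0 < Cmod w) by now apply Cmod_gt_0.
assert (Hray : forall s, 0 < s < 1 -> G (RtoC s * w)%C = G w).
{ intros s Hs.
  assert (E := eq_is_derive (V := C_R_NormedModule) (fun t => G (RtoC t * w)%C) s 1).
  cbv beta in E. rewrite E; [f_equal; ring| |lra].
  intros t Ht. apply rderiv_is_derive. change (zero : C) with (RtoC 0).
  replace (RtoC 0) with (0 * (1 * w + RtoC t * 0))%C by ring.
  apply (deriv_along_comp _ G (fun t => RtoC t * w)%C).
  - apply Hder.
    + rewrite Cmod_mult, Cmod_R, Rabs_pos_eq by lra. nra.
    + apply Cmult_neq_0; [|easy]. intros K; apply (f_equal fst) in K; simpl in K; lra.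
  - apply (deriv_along_mult RtoC RtoC (fun _ => w)); [apply deriv_along_id|apply deriv_along_const]. }
destruct (Hex 0) as [l Hl]; [rewrite Cmod_0; lra|].
destruct (deriv_along_lip _ _ _ _ Hl) as [d [Hd K]].
assert (Hl0 := Cmod_ge_0 l).
apply Cmod_eq_0, Rle_antisym; [|apply Cmod_ge_0].
apply le_epsilon. intros eps He. rewrite Rplus_0_l.
set (A := (Cmod l + 1) * Cmod w). assert (HA : 0 < A) by (apply Rmult_lt_0_compat; lra).
set (s := Rmin (Rmin (/ 2) (d / Cmod w / 2)) (eps / A)).
assert (Hs : 0 < s).
{ unfold s; repeat apply Rmin_pos; try lra.
  - repeat apply Rdiv_lt_0_compat; lra.
  - apply Rdiv_lt_0_compat; lra. }
assert (S1 : s <= / 2) by (eapply Rle_trans; apply Rmin_l).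
assert (S2 : s <= d / Cmod w / 2) by (eapply Rle_trans; [apply Rmin_l|apply Rmin_r]).
assert (S3 : s <= eps / A) by apply Rmin_r.
rewrite <- (Hray s) by lra.
assert (M : Cmod (RtoC s * w - 0) = s * Cmod w).
{ replace (RtoC s * w - 0)%C with (RtoC s * w)%C by ring.
  rewrite Cmod_mult, Cmod_R, Rabs_pos_eq; lra. }
specialize (K (RtoC s * w)%C). cbv beta in K. rewrite M, G0 in K.
replace (G (RtoC s * w) - 0)%C with (G (RtoC s * w)%C) in K by ring.
eapply Rle_trans; [apply K|].
- apply (Rmult_le_compat_r (Cmod w)) in S2; [|lra].
  replace (d / Cmod w / 2 * Cmod w) with (d / 2) in S2 by (field; lra). lra.
- apply (Rmult_le_compat_r A) in S3; [|lra].
  replace (eps / A * A) with eps in S3 by (field; lra).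
  unfold A in S3. lra.
Qed.

(** * The map [kappa] and the comparison of the two series near 0 *)

Definition kappa (w : C) : C := (4 * w / ((1 + w) * (1 + w)))%C.

Lemma cderiv_kappa w : Cmod w < 1 ->
  cderiv kappa w (4 * (1 - w) / ((1 + w) * (1 + w) * (1 + w)))%C.
Proof.
intros Hw. assert (N := one_plus_neq w Hw).
assert (D1 : cderiv (fun z => 1 + z)%C w (0 + 1)).
{ apply deriv_along_plus; [apply deriv_along_const|apply deriv_along_id]. }
replace (4 * (1 - w) / ((1 + w) * (1 + w) * (1 + w)))%C
  with ((4 * 1 * ((1 + w) * (1 + w)) - 4 * w * ((0 + 1) * (1 + w) + (1 + w) * (0 + 1)))
        / (((1 + w) * (1 + w)) * ((1 + w) * (1 + w))))%C by (field; easy).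
apply (cderiv_div (fun w => 4 * w)%C (fun w => (1 + w) * (1 + w))%C).
- now apply Cmult_neq_0.
- apply deriv_along_scal, deriv_along_id.
- now apply deriv_along_mult.
Qed.

Lemma one_minus_kappa w : Cmod w < 1 ->
  (1 - kappa w = ((1 - w) / (1 + w)) * ((1 - w) / (1 + w)))%C.
Proof. intros Hw. unfold kappa. field. now apply one_plus_neq. Qed.

(** On the slit 1 - kappa w = v^2 would be real and <= 0 for v = (1-w)/(1+w), but Re v = (1 -
    |w|^2)/|1+w|^2 > 0. *)
Lemma kappa_slit w : Cmod w < 1 -> slit_domain (kappa w).
Proof.
intros Hw [Him Hre].
assert (N := one_plus_neq w Hw).
assert (E := one_minus_kappa w Hw).
set (v := ((1 - w) / (1 + w))%C) in *.
assert (Hv : 0 < Re v).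
{ unfold v. destruct w as [x y].
  assert (Hxy : x ^ 2 + y ^ 2 < 1).
  { assert (H := Cmod2_alt (x, y)). unfold Re, Im in H; simpl fst in H; simpl snd in H.
    rewrite <- H. assert (P := Cmod_ge_0 (x, y)). nra. }
  unfold Cdiv, Cmult, Cinv, Cminus, Cplus, Copp, RtoC, Re; simpl.
  assert (D : 0 < (1 + x) * ((1 + x) * 1) + (0 + y) * ((0 + y) * 1)) by nra.
  replace (_ - _) with ((1 - (x ^ 2 + y ^ 2)) / ((1 + x) * ((1 + x) * 1) + (0 + y) * ((0 + y) * 1)))
    by (field; lra).
  apply Rdiv_lt_0_compat; lra. }
destruct v as [p q]. destruct (kappa w) as [a b].
unfold Re, Im in *; simpl in *.
assert (E1 := f_equal fst E). assert (E2 := f_equal snd E). simpl in E1, E2.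
subst b. assert (q = 0) by nra. nra.
Qed.

(** A convenient radius: |4w| < 1/2 and |1+w|^2 > (7/8)^2. On this disc the series in z at kappa w
    and the series in w both converge. *)
Lemma kappa_small w : Cmod w < / 8 -> Cmod (kappa w) < 1.
Proof.
intros Hw. assert (N := one_plus_neq w ltac:(lra)).
unfold kappa. rewrite Cmod_div by now apply Cmult_neq_0.
rewrite !Cmod_mult, Cmod_R, Rabs_pos_eq by lra.
assert (T : 1 <= Cmod (1 + w) + Cmod w).
{ rewrite <- Cmod_1 at 1. replace (RtoC 1) with ((1 + w) + - w)%C at 1 by ring.
  eapply Rle_trans; [apply Cmod_triangle|]. rewrite Cmod_opp; lra. }
apply Rlt_div_l; nra.
Qed.

Lemma kappa_0 : kappa 0 = 0.
Proof. unfold kappa. field. Qed.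

Lemma kappa_neq w : Cmod w < 1 -> w <> 0 -> kappa w <> 0.
Proof.
intros Hw H0 K. apply H0. assert (N := one_plus_neq w Hw).
replace w with (kappa w * ((1 + w) * (1 + w)) / 4)%C; [rewrite K; field|].
unfold kappa. field. easy.
Qed.

(** One integration step, common to both forms: the two sides vanish at 0 and, by the chain rule
    through [kappa], have the same derivative off 0; [l] is the derivative in z. *)
Lemma int_w_z_local (A B : nat -> R) (iw iz : (nat -> R) -> nat -> R) :
  disc_conv (iw A) -> disc_conv (iz B) -> iw A O = 0 -> iz B O = 0 ->
  (forall w, Cmod w < / 8 -> w <> 0 -> exists l,
     cderiv (Cpser (iz B)) (kappa w) l /\
     cderiv (Cpser (iw A)) w (l * (4 * (1 - w) / ((1 + w) * (1 + w) * (1 + w))))%C) ->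
  forall w, Cmod w < / 8 -> Cpser (iw A) w = Cpser (iz B) (kappa w).
Proof.
intros Hw Hz W0 Z0 H w Hlt.
apply Ceq_minus.
apply (zero_on_ball (fun w => Cpser (iw A) w - Cpser (iz B) (kappa w))%C (/ 8)); try easy.
- rewrite kappa_0, !Cpser_0, W0, Z0 by easy. ring.
- intros u Hu. eexists. apply deriv_along_minus.
  + apply cderiv_Cpser; [easy|lra].
  + apply (deriv_along_comp _ (Cpser (iz B)) kappa).
    * apply cderiv_Cpser; [easy|now apply kappa_small].
    * apply cderiv_kappa; lra.
- intros u Hu Hu0. destruct (H u Hu Hu0) as [l [H1 H2]].
  set (m := (l * (4 * (1 - u) / ((1 + u) * (1 + u) * (1 + u))))%C) in *.
  replace (RtoC 0) with (m - m)%C by ring.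
  apply deriv_along_minus; [exact H2|].
  apply (deriv_along_comp _ (Cpser (iz B)) kappa); [exact H1|]. apply cderiv_kappa; lra.
Qed.

(** The pullbacks by [kappa] of dz/(1-z) and dz/z are 4 dw/((1-w)(1+w)) and (1-w) dw/(w(1+w)), the
    forms behind [int1_w] and [int0_w]. Every step of the induction works on the same ball. *)
Lemma word_w_z_local k j w : Cmod w < / 8 ->
  Cpser (word_coef int1_w int0_w k j) w = Cpser (word_coef int1_z int0_z k j) (kappa w).
Proof.
revert w; induction j as [|j IH]; intros w Hw.
- simpl. rewrite !Cpser_unit; [easy|now apply kappa_small|lra].
- simpl. generalize (k (S j) - 1)%nat. intros p. revert w Hw.
  set (A := word_coef int1_w int0_w k j) in *. set (B := word_coef int1_z int0_z k j) in *.
  assert (HA : disc_conv A) by (apply disc_conv_word; [apply disc_conv_int1_w|apply disc_conv_int0_w]).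
  assert (HB : disc_conv B) by (apply disc_conv_word; [apply disc_conv_int1_z|apply disc_conv_int0_z]).
  induction p as [|p IHp]; simpl.
  + apply (int_w_z_local A B int1_w int1_z); try reflexivity.
    * now apply disc_conv_int1_w.
    * now apply disc_conv_int1_z.
    * intros w Hw Hw0. eexists. split; [apply cderiv_int1_z; [easy|now apply kappa_small]|].
      rewrite <- IH by easy. rewrite one_minus_kappa by lra.
      assert (N1 := one_minus_neq w ltac:(lra)). assert (N2 := one_plus_neq w ltac:(lra)).
      match goal with |- cderiv _ _ ?l =>
        replace l with (4 * Cpser A w / ((1 - w) * (1 + w)))%C by (field; now split) end.
      apply cderiv_int1_w; [easy|lra].
  + set (A' := block int1_w int0_w A p) in *. set (B' := block int1_z int0_z B p) in *.
    assert (HA' : disc_conv A') by (apply disc_conv_block; [apply disc_conv_int1_w|apply disc_conv_int0_w|easy]).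
    assert (HB' : disc_conv B') by (apply disc_conv_block; [apply disc_conv_int1_z|apply disc_conv_int0_z|easy]).
    assert (A0 : A' O = 0) by now apply block_O.
    assert (B0 : B' O = 0) by now apply block_O.
    apply (int_w_z_local A' B' int0_w int0_z); try reflexivity.
    * now apply disc_conv_int0_w.
    * now apply disc_conv_int0_z.
    * intros w Hw Hw0. eexists. split.
      { apply cderiv_int0_z; [easy|easy|now apply kappa_small|apply kappa_neq; [lra|easy]]. }
      rewrite <- IHp by easy. unfold kappa.
      assert (N1 := one_minus_neq w ltac:(lra)). assert (N2 := one_plus_neq w ltac:(lra)).
      match goal with |- cderiv _ _ ?l =>
        replace l with ((1 - w) * Cpser A' w / (w * (1 + w)))%C by (field; now split) end.
      apply cderiv_int0_w; try easy. lra.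
Qed.

Theorem mpl_kappa k n (Li : C -> C) w :
  (forall u, (1 <= u <= n)%nat -> (1 <= k u)%nat) -> is_mpl k n Li -> Cmod w < 1 ->
  Li (kappa w) = Cpser (word_coef int1_w int0_w k n) w.
Proof.
intros Hk [Hhol Hser] Hw.
assert (Hconv : disc_conv (word_coef int1_w int0_w k n))
  by (apply disc_conv_word; [apply disc_conv_int1_w|apply disc_conv_int0_w]).
apply Ceq_minus.
apply (disc_identity (fun w => Li (kappa w) - Cpser (word_coef int1_w int0_w k n) w)%C (/ 8));
  [lra| | |easy].
- intros z Hz. destruct (Hhol _ (kappa_slit z Hz)) as [l Hl].
  apply cderiv_is_derive in Hl. eexists. apply deriv_along_minus.
  + apply (deriv_along_comp _ Li kappa); [exact Hl|now apply cderiv_kappa].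
  + now apply cderiv_Cpser.
(* Here |kappa z| < 1, so the value of Li is its defining series, whose terms are those of the
   z-series by [word_coef_z]. *)
- intros z Hz. apply (proj1 (Ceq_minus _ _)).
  rewrite word_w_z_local by easy. symmetry. apply Cpser_unique.
  apply is_series_ext with (2 := Hser _ (kappa_small z Hz)).
  intros m. unfold mpl_term. now rewrite word_coef_z, pow_n_Cpow.
Qed.

(** * The arc and its lift to the disc *)

Definition tau (t : R) : R := sin (t / 4) / cos (t / 4).

(* tau t = tan(t/4), and wpath eps t is the point of the unit disc with
   kappa (wpath eps t) = 1 - e^{i eps t}. *)
Definition wpath (eps t : R) : C := (0, - eps * tau t).

(** A logarithm of 1 - e^{i eps t} = - 2 i eps sin(t/2) e^{i eps t/2} without the constant log(- i
    eps), which cancels in the differences that occur; thus no branch has to be chosen. *)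
Definition logpath (eps t : R) : C := (Afun t, eps * t / 2).

(** For t < PI, cos(t/2) = cos^2(t/4) - sin^2(t/4) is positive, which is what keeps [wpath] inside
    the open disc. *)
Lemma trig_pos t : 0 < t < PI ->
  0 < sin (t / 4) /\ 0 < cos (t / 4) /\ 0 < sin (t / 2) /\ sin (t / 4) < cos (t / 4).
Proof.
intros Ht.
assert (S4 : 0 < sin (t / 4)) by (apply sin_gt_0; lra).
assert (C4 : 0 < cos (t / 4)) by (apply cos_gt_0; lra).
assert (C2 : 0 < cos (t / 2)) by (apply cos_gt_0; lra).
assert (S2 : 0 < sin (t / 2)) by (apply sin_gt_0; lra).
repeat split; try easy.
replace (t / 2) with (2 * (t / 4)) in C2 by field. rewrite cos_2a in C2. nra.
Qed.

Lemma tau_bound t : 0 < t < PI -> 0 < tau t < 1.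
Proof.
intros Ht. destruct (trig_pos t Ht) as (S4 & C4 & _ & SC). unfold tau. split.
- now apply Rdiv_lt_0_compat.
- apply Rlt_div_l; lra.
Qed.

Section Path.
Variable eps : R.
Hypothesis Heps : eps = 1 \/ eps = -1.

Lemma eps_sqr : eps * eps = 1.
Proof. destruct Heps as [-> | ->]; ring. Qed.

Lemma Cmod_wpath t : 0 < t < PI -> Cmod (wpath eps t) = tau t.
Proof.
intros Ht. assert (H := tau_bound t Ht). unfold wpath, Cmod; simpl.
replace (0 * (0 * 1) + - eps * tau t * (- eps * tau t * 1)) with ((eps * eps) * (tau t) ^ 2) by ring.
rewrite eps_sqr, Rmult_1_l. apply sqrt_pow2; lra.
Qed.

Lemma wpath_lt_1 t : 0 < t < PI -> Cmod (wpath eps t) < 1.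
Proof. intros Ht. rewrite Cmod_wpath by easy. now apply tau_bound. Qed.

Lemma wpath_neq t : 0 < t < PI -> wpath eps t <> 0.
Proof. intros Ht. apply Cmod_gt_0. rewrite Cmod_wpath by easy. now apply tau_bound. Qed.

(** Since w^2 = - tan^2(t/4), the factor 1 + tan^2 from the derivative of the tangent equals
    (1-w)(1+w), ready to cancel against the denominators of the forms in w. *)
Lemma rderiv_wpath t : 0 < t < PI ->
  rderiv (wpath eps) t (- RtoC eps * Ci / 4 * ((1 - wpath eps t) * (1 + wpath eps t)))%C.
Proof.
intros Ht. destruct (trig_pos t Ht) as (S4 & C4 & _ & _).
replace (- RtoC eps * Ci / 4 * ((1 - wpath eps t) * (1 + wpath eps t)))%C
  with ((0, - eps * ((1 + tau t ^ 2) / 4)) : C).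
- apply (rderiv_pair (fun _ => 0) (fun t => - eps * tau t)).
  + apply (is_derive_const (K := R_AbsRing) (V := R_NormedModule)).
  + unfold tau. auto_derive; [change (t * / 4) with (t / 4); lra|].
    change (t * / 4) with (t / 4). field. lra.
- assert (E2 := eps_sqr).
  unfold wpath, Cdiv, Cmult, Cinv, Cminus, Cplus, Copp, Ci, RtoC; simpl. f_equal.
  + field.
  + replace (eps * tau t) with (eps * tau t) by ring.
    transitivity (- eps * ((1 + (eps * eps) * tau t ^ 2) / 4)); [rewrite E2|]; field.
Qed.

(** The value is the coefficient (1-w)/(w(1+w)) of dz/z in w times the velocity of [wpath]. The real
    part comes down to the duplication formula cot(t/2) = (cot(t/4) - tan(t/4))/2. *)
Lemma rderiv_logpath t : 0 < t < PI ->
  rderiv (logpath eps) t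
    (- RtoC eps * Ci / 4 * ((1 - wpath eps t) * (1 - wpath eps t)) / wpath eps t)%C.
Proof.
intros Ht. destruct (trig_pos t Ht) as (S4 & C4 & S2 & _).
assert (Tb := tau_bound t Ht).
replace (- RtoC eps * Ci / 4 * ((1 - wpath eps t) * (1 - wpath eps t)) / wpath eps t)%C
  with ((cos (t / 2) / sin (t / 2) / 2, eps / 2) : C).
- apply (rderiv_pair Afun (fun t => eps * t / 2)); [|auto_derive; [easy|field]].
  apply is_derive_ext_loc with (fun s => ln (2 * sin (s / 2))).
  + assert (Hl : locally t (fun s => 0 < s < PI)).
    { apply (open_and (fun s => 0 < s) (fun s => s < PI)); [apply open_gt|apply open_lt|easy]. }
    revert Hl. apply filter_imp. intros s Hs. unfold Afun.
    rewrite Rabs_pos_eq; [easy|]. destruct (trig_pos s Hs) as (_ & _ & P & _). lra.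
  + auto_derive; [change (t * / 2) with (t / 2); lra|].
    change (t * / 2) with (t / 2). field. lra.
- assert (Hw := wpath_neq t Ht).
  assert (E : cos (t / 2) / sin (t / 2) / 2 = (/ tau t - tau t) / 4).
  { unfold tau. replace (t / 2) with (2 * (t / 4)) by field.
    rewrite cos_2a, sin_2a. field. split; lra. }
  rewrite E.
  assert (M : forall a b : C, (a * wpath eps t = b -> a = b / wpath eps t)%C).
  { intros a b <-. field. easy. }
  apply M. assert (E2 := eps_sqr).
  unfold wpath, Cdiv, Cmult, Cinv, Cminus, Cplus, Copp, Ci, RtoC; simpl. f_equal.
  + transitivity (eps * eps * (tau t / 2)); field; lra.
  + transitivity (- eps * ((1 - eps * eps * tau t ^ 2) / 4)); [rewrite E2; field; lra|field].
Qed.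

Lemma kappa_wpath t : 0 < t < PI -> kappa (wpath eps t) = (1 - cexpi (eps * t))%C.
Proof.
intros Ht. destruct (trig_pos t Ht) as (S4 & C4 & S2 & _).
assert (N := one_plus_neq _ (wpath_lt_1 t Ht)).
assert (M : forall a b c : C, c <> 0 -> (a * c = b -> b / c = a)%C).
{ intros a b c Hc <-. field. easy. }
apply M; [now apply Cmult_neq_0|].
assert (P := sin2_cos2 (t / 4)). unfold Rsqr in P.
(* In terms of sin(t/4) and cos(t/4) both coordinates become rational identities modulo s^2 + c^2 =
   1 and eps^2 = 1. *)
assert (E : cexpi (eps * t) = (1 - 8 * sin (t / 4) ^ 2 * cos (t / 4) ^ 2,
   eps * (4 * sin (t / 4) * cos (t / 4) * (cos (t / 4) ^ 2 - sin (t / 4) ^ 2)))).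
{ unfold cexpi.
  replace (cos (eps * t)) with (cos t).
  2:{ destruct Heps as [-> | ->]; [now rewrite Rmult_1_l|].
      replace (-1 * t) with (- t) by ring. now rewrite cos_neg. }
  replace (sin (eps * t)) with (eps * sin t).
  2:{ destruct Heps as [-> | ->]; [now rewrite !Rmult_1_l|].
      replace (-1 * t) with (- t) by ring. rewrite sin_neg. ring. }
  replace t with (2 * (2 * (t / 4))) at 1 2 by field.
  rewrite (sin_2a (2 * (t / 4))), (cos_2a_sin (2 * (t / 4))), (cos_2a (t / 4)), !(sin_2a (t / 4)).
  f_equal; ring. }
rewrite E. unfold wpath, tau.
set (s := sin (t / 4)) in *. set (c := cos (t / 4)) in *.
assert (E2 := eps_sqr).
unfold Cmult, Cminus, Cplus, Copp, RtoC; simpl. f_equal.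
- transitivity (8 * s ^ 2 * c ^ 2 * (1 - (eps * eps) * (s / c) ^ 2)
     - (eps * eps) * (8 * s ^ 2 * (c ^ 2 - s ^ 2))); [field; lra|].
  rewrite E2. field. lra.
- transitivity (- (4 * eps * s / c) * ((4 * s ^ 2 * c ^ 2) + (c ^ 2 - s ^ 2) * (c ^ 2 - (eps * eps) * s ^ 2)));
    [field; lra|].
  rewrite E2.
  replace (4 * s ^ 2 * c ^ 2 + (c ^ 2 - s ^ 2) * (c ^ 2 - 1 * s ^ 2))
    with ((s * s + c * c) * (s * s + c * c)) by ring.
  rewrite P. field. lra.
Qed.

End Path.

(** * The iterated integral *)

(** From exp x = exp(x/(q+1))^(q+1) >= (x/(q+1))^(q+1). The exponent q + 1 instead of q leaves the
    factor 1/x that provides the decay. *)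
Lemma pow_exp_bound (q : nat) (x : R) : 0 < x -> x ^ q * exp (- x) <= INR (S q) ^ S q / x.
Proof.
intros Hx.
assert (Hq : 0 < INR (S q)) by (apply lt_0_INR; lia).
assert (E : (x / INR (S q)) ^ S q <= exp x).
{ replace x with (INR (S q) * (x / INR (S q))) at 2 by (field; lra).
  replace (exp (INR (S q) * (x / INR (S q)))) with (exp (x / INR (S q)) ^ S q).
  - apply pow_incr. assert (H := exp_ineq1_le (x / INR (S q))).
    assert (0 < x / INR (S q)) by (apply Rdiv_lt_0_compat; lra). lra.
  - generalize (x / INR (S q)). generalize (S q). clear. intros n y. induction n as [|n IH].
    + simpl. now rewrite Rmult_0_l, exp_0.
    + rewrite S_INR. simpl. rewrite IH, <- exp_plus. f_equal; ring. }
rewrite exp_Ropp. assert (P := exp_pos x).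
assert (Pq : 0 < INR (S q) ^ S q) by now apply pow_lt.
apply Rmult_le_reg_r with x; [exact Hx|].
replace (INR (S q) ^ S q / x * x) with (INR (S q) ^ S q) by (field; lra).
replace (x ^ q * / exp x * x) with (x ^ S q / exp x) by (unfold Rdiv; rewrite <- (tech_pow_Rmult x q); ring).
apply Rle_div_l; [exact P|].
unfold Rdiv in E. rewrite Rpow_mult_distr, pow_inv in E.
apply (Rmult_le_compat_r (INR (S q) ^ S q)) in E; [|lra].
rewrite Rmult_assoc, Rinv_l, Rmult_1_r in E by lra. lra.
Qed.

Section Antiderivative.
Variable eps : R.
Hypothesis Heps : eps = 1 \/ eps = -1.

Definition along (a : nat -> R) (t : R) : C := Cpser a (wpath eps t).

Lemma rderiv_along_int1 a t : disc_conv a -> 0 < t < PI ->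
  rderiv (along (int1_w a)) t (- RtoC eps * Ci * along a t)%C.
Proof.
intros Ha Ht.
assert (Hw := wpath_lt_1 eps Heps t Ht).
assert (N1 := one_minus_neq _ Hw). assert (N2 := one_plus_neq _ Hw).
replace (- RtoC eps * Ci * along a t)%C
  with (4 * Cpser a (wpath eps t) / ((1 - wpath eps t) * (1 + wpath eps t))
        * (- RtoC eps * Ci / 4 * ((1 - wpath eps t) * (1 + wpath eps t))))%C.
- apply (deriv_along_comp _ (Cpser (int1_w a)) (wpath eps)).
  + now apply cderiv_int1_w.
  + now apply rderiv_wpath.
- unfold along. field. now split.
Qed.

Definition dlog (t : R) : C :=
  (- RtoC eps * Ci / 4 * ((1 - wpath eps t) * (1 - wpath eps t)) / wpath eps t)%C.

Lemma rderiv_along_int0 a t : disc_conv a -> a O = 0 -> 0 < t < PI ->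
  rderiv (along (int0_w a)) t (dlog t * along a t)%C.
Proof.
intros Ha H0 Ht.
assert (Hw := wpath_lt_1 eps Heps t Ht). assert (Hw0 := wpath_neq eps Heps t Ht).
assert (N1 := one_minus_neq _ Hw). assert (N2 := one_plus_neq _ Hw).
replace (dlog t * along a t)%C
  with ((1 - wpath eps t) * Cpser a (wpath eps t) / (wpath eps t * (1 + wpath eps t))
        * (- RtoC eps * Ci / 4 * ((1 - wpath eps t) * (1 + wpath eps t))))%C.
- apply (deriv_along_comp _ (Cpser (int0_w a)) (wpath eps)).
  + now apply cderiv_int0_w.
  + now apply rderiv_wpath.
- unfold along, dlog. field. now split.
Qed.

Lemma rderiv_along a t : disc_conv a -> 0 < t < PI -> exists l, rderiv (along a) t l.
Proof.
intros Ha Ht. eexists. apply (deriv_along_comp _ (Cpser a) (wpath eps)).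
- apply cderiv_Cpser; [easy|now apply wpath_lt_1].
- now apply rderiv_wpath.
Qed.

(** The factor 1/q! makes the derivative in s a multiple of the [logpow] of index one lower, which
    drives the telescoping. *)
Definition logpow (t : R) (q : nat) (s : R) : C :=
  ((logpath eps t - logpath eps s) ^ q * RtoC (/ INR (fact q)))%C.

Lemma rderiv_logdiff t s : 0 < s < PI ->
  rderiv (fun s => logpath eps t - logpath eps s)%C s (- dlog s)%C.
Proof.
intros Hs. replace (- dlog s)%C with (0 - dlog s)%C by ring.
apply deriv_along_minus; [apply deriv_along_const|now apply rderiv_logpath].
Qed.

Lemma rderiv_logpow t q s : 0 < s < PI ->
  rderiv (logpow t (S q)) s (- dlog s * logpow t q s)%C.
Proof.
intros Hs. unfold logpow.
replace (- dlog s * ((logpath eps t - logpath eps s) ^ q * RtoC (/ INR (fact q))))%C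
  with ((RtoC (INR (S q)) * (logpath eps t - logpath eps s) ^ q * - dlog s)
          * RtoC (/ INR (fact (S q))) + (logpath eps t - logpath eps s) ^ S q * 0)%C.
- apply (deriv_along_mult _ (fun s => (logpath eps t - logpath eps s) ^ S q)%C
           (fun _ => RtoC (/ INR (fact (S q)))));
    [|apply deriv_along_const].
  apply (deriv_along_pow _ (fun s => logpath eps t - logpath eps s)%C). now apply rderiv_logdiff.
- replace (/ INR (fact (S q))) with (/ INR (S q) * / INR (fact q)).
  + rewrite RtoC_mult, (RtoC_inv (INR (S q))) by (apply not_0_INR; lia).
    field. intros K. apply (f_equal fst) in K. revert K. apply not_0_INR; lia.
  + rewrite fact_simpl, mult_INR. field. split; [apply INR_fact_neq_0|apply not_0_INR; lia].
Qed.

Lemma rderiv_logpow_ex t q s : 0 < s < PI -> exists l, rderiv (logpow t q) s l.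
Proof.
intros Hs. destruct q as [|q].
- exists 0. apply deriv_along_ext with (fun _ => logpow t 0 s); [easy|apply deriv_along_const].
- eexists. now apply rderiv_logpow.
Qed.

Lemma logpow_diag t q : logpow t (S q) t = 0.
Proof. unfold logpow. simpl. ring. Qed.

(* sum_{q <= p} L^q/q! Li_{.., r+p-q} with L = log z_t - log z_s: all but the
   last term of its derivative in s telescope. *)
Fixpoint antideriv (a : nat -> R) (t : R) (p r : nat) (s : R) : C :=
  match p with
  | O => logpow t 0 s * along (block int1_w int0_w a r) s
  | S p' => antideriv a t p' (S r) s + logpow t p s * along (block int1_w int0_w a r) s
  end%C.

Section Block.
Variable a : nat -> R.
Hypothesis Ha : disc_conv a.

Lemma disc_conv_block_w p : disc_conv (block int1_w int0_w a p).
Proof. apply disc_conv_block; [apply disc_conv_int1_w|apply disc_conv_int0_w|easy]. Qed.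

Lemma block_w_O p : block int1_w int0_w a p O = 0.
Proof. now apply block_O. Qed.

(** Neighbouring terms cancel: deriving the block in one gives [dlog] times the next lower block,
    and deriving the power of L in the next gives the same with opposite sign. With [S r] every
    block ends in [int0_w], so only the extreme term with L^p/p! survives. *)
Lemma rderiv_antideriv_S t p r s : 0 < s < PI ->
  rderiv (antideriv a t p (S r)) s
    (dlog s * logpow t p s * along (block int1_w int0_w a r) s)%C.
Proof.
intros Hs. revert r; induction p as [|p IH]; intros r.
- replace (dlog s * logpow t 0 s * along (block int1_w int0_w a r) s)%C
    with (0 * along (block int1_w int0_w a (S r)) s
          + logpow t 0 s * (dlog s * along (block int1_w int0_w a r) s))%C by ring.
  apply deriv_along_mult.
  + apply deriv_along_ext with (fun _ => logpow t 0 s); [easy|apply deriv_along_const].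
  + apply rderiv_along_int0; [apply disc_conv_block_w|apply block_w_O|easy].
- replace (dlog s * logpow t (S p) s * along (block int1_w int0_w a r) s)%C
    with (dlog s * logpow t p s * along (block int1_w int0_w a (S r)) s
          + ((- dlog s * logpow t p s) * along (block int1_w int0_w a (S r)) s
             + logpow t (S p) s * (dlog s * along (block int1_w int0_w a r) s)))%C by ring.
  apply deriv_along_plus; [apply IH|].
  apply deriv_along_mult; [now apply rderiv_logpow|].
  apply rderiv_along_int0; [apply disc_conv_block_w|apply block_w_O|easy].
Qed.

(** The lowest block is now a single [int1_w], whose derivative carries the constant - i eps instead
    of [dlog]; the term left over by [rderiv_antideriv_S] cancels as before. *)
Lemma rderiv_antideriv t p s : 0 < s < PI ->
  rderiv (antideriv a t p 0) s (- RtoC eps * Ci * (logpow t p s * along a s))%C.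
Proof.
intros Hs. destruct p as [|p].
- replace (- RtoC eps * Ci * (logpow t 0 s * along a s))%C
    with (0 * along (block int1_w int0_w a 0) s
          + logpow t 0 s * (- RtoC eps * Ci * along a s))%C by ring.
  apply deriv_along_mult; [|now apply rderiv_along_int1].
  apply deriv_along_ext with (fun _ => logpow t 0 s); [easy|apply deriv_along_const].
- replace (- RtoC eps * Ci * (logpow t (S p) s * along a s))%C
    with (dlog s * logpow t p s * along (block int1_w int0_w a 0) s
          + ((- dlog s * logpow t p s) * along (block int1_w int0_w a 0) s
             + logpow t (S p) s * (- RtoC eps * Ci * along a s)))%C by ring.
  apply deriv_along_plus; [now apply rderiv_antideriv_S|].
  apply deriv_along_mult; [now apply rderiv_logpow|now apply rderiv_along_int1].
Qed.

Lemma antideriv_diag t p r : antideriv a t p r t = along (block int1_w int0_w a (p + r)) t.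
Proof.
revert r; induction p as [|p IH]; intros r.
- unfold antideriv, logpow. simpl. rewrite Rinv_1. ring.
- cbn [antideriv]. rewrite IH, logpow_diag.
  replace (p + S r)%nat with (S p + r)%nat by lia. ring.
Qed.

End Block.

(** A power of a logarithm against a linear zero. With x = 2 sin(s/2) and u = - ln x one has |L| <=
    N + u and a series value of at most K x = K exp(-u). For y = N + u the product is at most K
    exp(N) y^q exp(-y), hence at most D/y by [pow_exp_bound]. *)
Lemma logpow_along_small t q b : disc_conv b -> b O = 0 ->
  forall e, 0 < e -> exists d, 0 < d /\ forall s, 0 < s < d -> Cmod (logpow t q s * along b s) <= e.
Proof.
intros Hb H0 e He.
destruct (deriv_along_lip _ _ _ _ (cderiv_Cpser b 0 Hb ltac:(rewrite Cmod_0; lra)))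
  as [d0 [Hd0 K0]].
set (K := Cmod (Cpser (PS_derive b) 0) + 1) in *.
assert (HK : 0 < K) by (assert (P := Cmod_ge_0 (Cpser (PS_derive b) 0)); unfold K; lra).
set (N := Cmod (logpath eps t) + 1). assert (HN : 1 <= N) by (assert (P := Cmod_ge_0 (logpath eps t)); unfold N; lra).
set (D := K * exp N * INR (S q) ^ S q).
assert (HD : 0 < D).
{ apply Rmult_lt_0_compat; [apply Rmult_lt_0_compat; [easy|apply exp_pos]|].
  apply pow_lt, lt_0_INR; lia. }
(* The last bound forces u > D/e because x < s; the others keep s below PI and the point w within
   the range of the Lipschitz estimate. *)
set (d := Rmin (Rmin 1 d0) (exp (- (D / e)))).
assert (Hd : 0 < d) by (unfold d; repeat apply Rmin_pos; try lra; apply exp_pos).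
exists d; split; [easy|]. intros s [Hs Hsd].
assert (D1 : d <= 1) by (eapply Rle_trans; apply Rmin_l).
assert (D2 : d <= d0) by (eapply Rle_trans; [apply Rmin_l|apply Rmin_r]).
assert (D3 : d <= exp (- (D / e))) by apply Rmin_r.
assert (HPI := PI2_1).
assert (HsPI : 0 < s < PI) by lra.
destruct (trig_pos s HsPI) as (S4 & C4 & S2 & SC).
set (x := 2 * sin (s / 2)).
assert (Hx0 : 0 < x) by (unfold x; lra).
assert (Hxs : x < s).
{ unfold x. assert (L := sin_lt_x (s / 2) ltac:(lra)). lra. }
assert (Htau : tau s <= x).
{ unfold x, tau. replace (s / 2) with (2 * (s / 4)) by field. rewrite sin_2a.
  apply Rle_div_l; [easy|].
  assert (P := sin2_cos2 (s / 4)). unfold Rsqr in P.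
  assert (Q : / 2 <= cos (s / 4) * cos (s / 4)) by nra.
  replace (2 * (2 * sin (s / 4) * cos (s / 4)) * cos (s / 4))
    with (4 * (cos (s / 4) * cos (s / 4)) * sin (s / 4)) by ring. nra. }
set (u := - ln x).
assert (Hu : D / e < u).
{ unfold u. assert (L : ln x < - (D / e)); [|lra].
  rewrite <- (ln_exp (- (D / e))). apply ln_increasing; lra. }
assert (HDe : 0 < D / e) by (apply Rdiv_lt_0_compat; lra).
assert (Hln : ln x < 0) by (unfold u in Hu; lra).
assert (Ex : exp (- u) = x) by (unfold u; rewrite Ropp_involutive; now apply exp_ln).
assert (HL : Cmod (logpath eps t - logpath eps s) <= N + u).
{ unfold Cminus. eapply Rle_trans; [apply Cmod_triangle|]. rewrite Cmod_opp.
  assert (Cmod (logpath eps s) <= 1 + u); [|unfold N; lra].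
  unfold logpath. eapply Rle_trans; [apply Cmod_le_abs|].
  unfold Afun. fold x. rewrite (Rabs_pos_eq x), (Rabs_left (ln x)) by lra.
  fold u. assert (Rabs (eps * s / 2) <= 1); [|lra].
  unfold Rdiv. rewrite !Rabs_mult, (Rabs_pos_eq s), (Rabs_pos_eq (/ 2)) by lra.
  assert (Rabs eps = 1) as ->; [|lra].
  destruct Heps as [-> | ->]; [apply Rabs_R1|rewrite Rabs_left; lra]. }
assert (HA : Cmod (along b s) <= K * x).
{ unfold along. assert (E : Cmod (wpath eps s - 0) = tau s).
  { replace (wpath eps s - 0)%C with (wpath eps s) by ring. now apply Cmod_wpath. }
  specialize (K0 (wpath eps s)). cbv beta in K0. rewrite E in K0.
  rewrite Cpser_0, H0 in K0 by easy.
  replace (Cpser b (wpath eps s) - 0)%C with (Cpser b (wpath eps s)) in K0 by ring.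
  eapply Rle_trans; [apply K0; lra|]. apply Rmult_le_compat_l; lra. }
assert (HP : Cmod (logpow t q s) <= (N + u) ^ q).
{ unfold logpow. rewrite Cmod_mult, Cmod_pow, Cmod_R.
  assert (F : 1 <= INR (fact q)) by (apply (le_INR 1), lt_O_fact).
  rewrite Rabs_pos_eq by (left; apply Rinv_0_lt_compat; lra).
  rewrite <- (Rmult_1_r ((N + u) ^ q)).
  apply Rmult_le_compat.
  - apply pow_le, Cmod_ge_0.
  - left; apply Rinv_0_lt_compat; lra.
  - apply pow_incr; split; [apply Cmod_ge_0|easy].
  - rewrite <- Rinv_1. apply Rinv_le_contravar; lra. }
rewrite Cmod_mult.
apply Rle_trans with ((N + u) ^ q * (K * x)).
{ apply Rmult_le_compat; try apply Cmod_ge_0; easy. }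
rewrite <- Ex. replace (exp (- u)) with (exp N * exp (- (N + u))).
2:{ rewrite <- exp_plus. f_equal; ring. }
assert (B := pow_exp_bound q (N + u) ltac:(lra)).
apply Rle_trans with (D / (N + u)).
- replace ((N + u) ^ q * (K * (exp N * exp (- (N + u)))))
    with (K * exp N * ((N + u) ^ q * exp (- (N + u)))) by ring.
  replace (D / (N + u)) with (K * exp N * (INR (S q) ^ S q / (N + u))) by (unfold D; field; lra).
  apply Rmult_le_compat_l; [|easy]. apply Rmult_le_pos; [lra|left; apply exp_pos].
- apply Rle_div_l; [lra|]. apply Rlt_div_l in Hu; [|easy]. nra.
Qed.

Lemma antideriv_small a t p r : disc_conv a ->
  forall e, 0 < e -> exists d, 0 < d /\ forall s, 0 < s < d -> Cmod (antideriv a t p r s) <= e.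
Proof.
intros Ha. revert r; induction p as [|p IH]; intros r e He.
- apply logpow_along_small; [now apply disc_conv_block_w|apply block_w_O|easy].
- destruct (IH (S r) (e / 2)) as [d1 [Hd1 K1]]; [lra|].
  destruct (logpow_along_small t (S p) (block int1_w int0_w a r)
    (disc_conv_block_w a Ha r) (block_w_O a r) (e / 2)) as [d2 [Hd2 K2]]; [lra|].
  exists (Rmin d1 d2); split; [now apply Rmin_pos|]. intros s Hs.
  assert (M1 := Rmin_l d1 d2). assert (M2 := Rmin_r d1 d2).
  cbn [antideriv]. eapply Rle_trans; [apply Cmod_triangle|].
  specialize (K1 s ltac:(lra)). specialize (K2 s ltac:(lra)). lra.
Qed.

(** The fundamental theorem on [a,t], followed by a -> 0+. The integrand [f], which will contain an
    iterated integral, is replaced on (0,t) by [df], whose differentiability supplies the continuity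
    required for integration. *)
Lemma is_RInt_gen_antideriv (f F df : R -> C) t : 0 < t < PI ->
  (forall s, 0 < s < t -> f s = df s) ->
  (forall s, 0 < s < PI -> rderiv F s (df s)) ->
  (forall s, 0 < s < PI -> exists l, rderiv df s l) ->
  (forall e, 0 < e -> exists d, 0 < d /\ forall s, 0 < s < d -> Cmod (F s) <= e) ->
  is_RInt_gen (V := C_R_NormedModule) f (at_right 0) (at_point t) (F t).
Proof.
intros Ht Hf HF Hdf H0 P [e HP].
destruct (H0 (e / 2)) as [d [Hd K]]; [assert (Q := cond_pos e); lra|].
apply (Filter_prod _ _ _ (fun a => 0 < a < Rmin d t) (fun b => b = t)).
- exists (mkposreal (Rmin d t) (Rmin_pos _ _ Hd (proj1 Ht))). intros y Hy Hy0.
  change (Rabs (y - 0) < Rmin d t) in Hy. rewrite Rminus_0_r in Hy.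
  apply Rabs_lt_between in Hy. lra.
- reflexivity.
- intros a b Hab ->. exists (F t - F a)%C.
  assert (M1 := Rmin_l d t). assert (M2 := Rmin_r d t). simpl. split.
  + apply (is_RInt_ext (V := C_R_NormedModule) df).
    * intros s. rewrite Rmin_left, Rmax_right by lra. intros Hs. symmetry. apply Hf; lra.
    * apply is_CInt_rderiv; [lra| |]; intros s Hs; [apply HF|apply Hdf]; lra.
  + apply HP. apply C_NormedModule_mixin_compat1.
    change (Cmod ((F t - F a) - F t) < e).
    replace (F t - F a - F t)%C with (- F a)%C by ring. rewrite Cmod_opp.
    specialize (K a ltac:(lra)). assert (Q := cond_pos e). lra.
Qed.

(** * Evaluation of the iterated integrals *)

Lemma integrand_factor_logpow k u s t :
  integrand_factor eps k u s t = logpow t (k u - 1) s.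
Proof.
unfold integrand_factor, logpow. rewrite pow_n_Cpow. f_equal. f_equal.
unfold logpath, Cminus, Cplus, Copp, Cmult, RtoC, Ci; simpl. f_equal; field.
Qed.

(** As eps^2 = 1, the constant c = i eps is inverse to - i eps. Multiplying [antideriv] by c^(j+1)
    therefore leaves the derivative c^j L^p/p! times the series of depth j, which is the integrand
    by the hypothesis at j. *)
Lemma iter_int_step k j t : 0 < t < PI ->
  (forall s, 0 < s < PI ->
     iter_int eps k j s = ((RtoC eps * Ci) ^ j * along (word_coef int1_w int0_w k j) s)%C) ->
  is_RInt_gen (V := C_R_NormedModule)
    (fun s => Cmult (integrand_factor eps k (S j) s t) (iter_int eps k j s))
    (at_right 0) (at_point t)
    ((RtoC eps * Ci) ^ S j * along (word_coef int1_w int0_w k (S j)) t)%C.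
Proof.
intros Ht IH.
set (a := word_coef int1_w int0_w k j) in *.
assert (Ha : disc_conv a) by (apply disc_conv_word; [apply disc_conv_int1_w|apply disc_conv_int0_w]).
set (p := (k (S j) - 1)%nat).
set (c := (RtoC eps * Ci)%C) in *.
assert (Hc : (c * (- RtoC eps * Ci) = 1)%C).
{ assert (E2 := eps_sqr eps Heps). unfold c, Cmult, Copp, Ci, RtoC; simpl. f_equal; [|ring].
  transitivity (eps * eps); [ring|exact E2]. }
assert (Hcm : Cmod c = 1).
{ unfold c. rewrite Cmod_mult, Cmod_Ci, Cmod_R.
  destruct Heps as [-> | ->]; [rewrite Rabs_R1|rewrite Rabs_left]; lra. }
replace (along (word_coef int1_w int0_w k (S j)) t) with (antideriv a t p 0 t).
2:{ rewrite antideriv_diag, Nat.add_0_r. reflexivity. }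
apply (is_RInt_gen_antideriv _ (fun s => c ^ S j * antideriv a t p 0 s)%C
        (fun s => c ^ S j * (- RtoC eps * Ci * (logpow t p s * along a s)))%C t Ht).
- intros s Hs. rewrite integrand_factor_logpow, IH by lra. fold p.
  simpl. transitivity ((c * (- RtoC eps * Ci)) * (c ^ j * (logpow t p s * along a s)))%C; [rewrite Hc|]; ring.
- intros s Hs. apply deriv_along_scal. now apply rderiv_antideriv.
- intros s Hs. destruct (rderiv_logpow_ex t p s Hs) as [l1 H1].
  destruct (rderiv_along a s Ha Hs) as [l2 H2].
  eexists. apply deriv_along_scal, deriv_along_scal, deriv_along_mult; [exact H1|exact H2].
- intros e He. destruct (antideriv_small a t p 0 Ha e He) as [d [Hd K]].
  exists d; split; [easy|]. intros s Hs.
  rewrite Cmod_mult, Cmod_pow, Hcm, pow1, Rmult_1_l. now apply K.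
Qed.

(** The induction runs over all t in (0,PI), as the inner integral is evaluated at every point below
    t. Each level obtains convergence and value together from [iter_int_step]. *)
Lemma iter_int_value k j t : 0 < t < PI ->
  iter_int eps k j t = ((RtoC eps * Ci) ^ j * along (word_coef int1_w int0_w k j) t)%C.
Proof.
revert t; induction j as [|j IH]; intros t Ht.
- simpl. unfold along. rewrite Cpser_unit by now apply wpath_lt_1. ring.
- apply (is_RInt_gen_unique (V := C_R_CompleteNormedModule)).
  now apply iter_int_step.
Qed.

End Antiderivative.

Theorem theorem3p8 (n : nat) (k : nat -> nat) (sigma eps : R) (Li : C -> C) :
  (1 <= n)%nat ->
  (forall u : nat, (1 <= u <= n)%nat -> (1 <= k u)%nat) ->
  0 < sigma < PI ->
  (eps = 1 \/ eps = -1) ->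
  is_mpl k n Li ->
  iter_int_exists eps k n sigma /\
  Li (Cminus (RtoC 1) (cexpi (eps * sigma))) =
  Cmult (pow_n (K := C_Ring) (Cmult (RtoC (- eps)) Ci) n) (iter_int eps k n sigma).
Proof.
intros _ Hk Hsigma Heps HLi. split.
- intros u t Hu Ht. destruct u as [|j]; [lia|].
  rewrite Nat.sub_succ, Nat.sub_0_r.
  eexists. apply iter_int_step; [easy|lra|]. intros s Hs. now apply iter_int_value.
- rewrite <- kappa_wpath, (mpl_kappa k n), iter_int_value, pow_n_Cpow by (easy || now apply wpath_lt_1).
  (* The constants combine to (- i eps)^n (i eps)^n = 1. *)
  rewrite Cmult_assoc, <- Cpow_mult_l.
  replace (RtoC (- eps) * Ci * (RtoC eps * Ci))%C with (RtoC 1).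
  + rewrite Cpow_1_l, Cmult_1_l. reflexivity.
  + assert (E2 := eps_sqr eps Heps). unfold Cmult, Ci, RtoC; simpl. f_equal; [|ring].
    transitivity (eps * eps); [now rewrite E2|ring].
Qed.
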